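(* Let $d$ be a derivation on $L$ such that $L=\ker_L d\oplus d(L)$. For any $u\in L$, there exists $v\in\ker_L d$ such that $u\sim_d v$. Moreover, if $v\in\ker_L d$ is $d$-conjugate to $u$, then an element $w\in\ker_L d$ is $d$-conjugate to $u$ if and only if there exists $\varphi\in\exp(\ker_L d)$ such that $$v\varphi=\varphi w.$$
   Context: Let $k$ be a field of characteristic $0$ and $\bigoplus_{n\ge1}L^k_n$ a graded Lie algebra over $k$ with finite-dimensional components and $[L^k_n,L^k_m]\subset L^k_{n+m}$. For a commutative $k$-algebra $\mathcal A$ (possibly $\mathcal A=k$), $L=L^{\mathcal A}=\prod_{n\ge1}L_n$ with $L_n=\mathcal A\otimes_k L^k_n$ and bracket induced by $[a\otimes x,b\otimes y]=(ab)\otimes[x,y]$, extended componentwise to the product. $\mathcal U=\prod_{n\ge0}\mathcal U_n$ is the completion of the graded universal enveloping algebra (over $k$) of $\bigoplus_n L_n$, with $\mathcal U_0=k\cdot1$. $G\subset\mathcal U$ is the group of group-like elements for the coproduct with $\Delta(x)=1\otimes x+x\otimes1$ for $x\in L$; equivalently $G=\exp(L)$. A derivation on $L$ is a graded $k$-linear endomorphism $d$ ($d(L_n)\subset L_n$, acting componentwise) with $d([x,y])=[d(x),y]+[x,d(y)]$. It extends to a graded derivation of $\mathcal U$: $d(1)=0$, $d(\mathcal U_n)\subset\mathcal U_n$, $d(xy)=d(x)y+x\,d(y)$. $\ker_L d=\ker d\cap L$. Two elements $u,v\in L$ are $d$-conjugate, written $u\sim_d v$, if there exists $\varphi\in G$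 with $d(\varphi)+v\varphi=\varphi u$; this is an equivalence relation on $L$. *)

(* Defs.v *)
(* Classical logic (boolp) is used only to make quotients by undecidable
   submodules available through ring_quotient. *)
From HB Require Import structures.
From mathcomp Require Import all_boot all_algebra.
From mathcomp Require Import boolp.
From mathcomp Require Import finmap monalg.

Set Implicit Arguments.
Unset Strict Implicit.
Unset Printing Implicit Defensive.

Import GRing.Theory.
Local Open Scope ring_scope.
Local Open Scope quotient_scope.

Inductive span (k : pzRingType) (V : lmodType k) (S : V -> Prop) : V -> Prop :=
| span0 : span S 0
| spanD x y : span S x -> span S y -> span S (x + y)
| spanZ c x : S x -> span S (c *: x).

Lemma span_sub (k : pzRingType) (V : lmodType k) (S : V -> Prop) x :
  S x -> span S x.
Proof. by move=> Sx; rewrite -[x]scale1r; exact: spanZ. Qed.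

Lemma span_scale (k : pzRingType) (V : lmodType k) (S : V -> Prop) c x :
  span S x -> span S (c *: x).
Proof.
elim=> [|y z _ hy _ hz|a y Sy]; first by rewrite scaler0; exact: span0.
  by rewrite scalerDr; exact: spanD.
by rewrite scalerA; exact: spanZ.
Qed.

Lemma span_ker (k : pzRingType) (V W : lmodType k) (S : V -> Prop)
    (F : {linear V -> W}) x :
  (forall y, S y -> F y = 0) -> span S x -> F x = 0.
Proof.
move=> FS; elim=> [|y z _ hy _ hz|a y Sy]; first exact: linear0.
  by rewrite linearD hy hz addr0.
by rewrite linearZ FS //= scaler0.
Qed.

Section LinearEq0.
Variables (k : pzRingType) (V W : lmodType k) (F : {linear V -> W}).
Lemma linear_eq0D x y z : F (x - y - z) = 0 -> F x = F y + F z.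
Proof. by rewrite -addrA -opprD linearB linearD => /eqP; rewrite subr_eq0 => /eqP. Qed.
Lemma linear_eq0Z x c y : F (x - c *: y) = 0 -> F x = c *: F y.
Proof. by rewrite linearB linearZ => /eqP; rewrite subr_eq0 => /eqP. Qed.
Lemma linear_eq0L x y z : F (x - y - z) = 0 -> F z = F x - F y.
Proof. by rewrite 2!linearB => /eqP; rewrite subr_eq0 => /eqP. Qed.
Lemma linear_eq0B x y z : F x = 0 -> F y = 0 -> F z = 0 -> F (x - y - z) = 0.
Proof. by move=> hx hy hz; rewrite 2!linearB /= hx hy hz !subr0. Qed.
Lemma linear_eqD x y z : F x = F y + F z -> F (x - y - z) = 0.
Proof. by move=> h; rewrite 2!linearB /= h -addrA -opprD subrr. Qed.
Lemma linear_eqZ x c y : F x = c *: F y -> F (x - c *: y) = 0.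
Proof. by move=> h; rewrite linearB linearZ /= h subrr. Qed.
Lemma linear_eqB x y z : F z = F x - F y -> F (x - y - z) = 0.
Proof. by move=> h; rewrite 2!linearB /= h subrr. Qed.
End LinearEq0.

Section Quotient.
Variables (k : pzRingType) (V : lmodType k) (S : V -> Prop).

Definition spanp : pred V := fun x => `[< span S x >].

Fact spanp_zmod : zmod_closed spanp.
Proof.
split=> [|x y /asboolP hx /asboolP hy]; apply/asboolP; first exact: span0.
by apply: spanD => //; rewrite -scaleN1r; exact: span_scale.
Qed.
HB.instance Definition _ := GRing.isZmodClosed.Build V spanp spanp_zmod.

Definition quotm := {ideal_quot (GRing.ZmodClosed.clone V spanp _)}.
HB.instance Definition _ := EqQuotient.on quotm.
HB.instance Definition _ := GRing.Zmodule.on quotm.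

Definition proj (v : V) : quotm := \pi_quotm v.

Lemma projP x y : proj x = proj y <-> span S (x - y).
Proof.
rewrite /proj; split.
  by move/eqP; rewrite -Quotient.idealrBE => /asboolP.
by move=> h; apply/eqP; rewrite -Quotient.idealrBE; apply/asboolP.
Qed.

Lemma projD x y : proj (x + y) = proj x + proj y.
Proof. exact: Quotient.pi_add. Qed.

Lemma proj_repr (x : quotm) : proj (repr x) = x.
Proof. exact: reprK. Qed.

Lemma repr_proj x : span S (repr (proj x) - x).
Proof. by apply/projP; rewrite proj_repr. Qed.

Definition quotm_scale c (x : quotm) : quotm := proj (c *: repr x).

Lemma proj_scale c x : proj (c *: x) = quotm_scale c (proj x).
Proof.
apply/projP; rewrite -scalerBr; apply: span_scale.
by apply/projP; rewrite proj_repr.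
Qed.

Fact quotm_scaleA a b x : quotm_scale a (quotm_scale b x) = quotm_scale (a * b) x.
Proof. by rewrite -[x]proj_repr -!proj_scale scalerA. Qed.
Fact quotm_scale1 : left_id 1 quotm_scale.
Proof. by move=> x; rewrite -[x]proj_repr -!proj_scale scale1r. Qed.
Fact quotm_scaleDr : right_distributive quotm_scale +%R.
Proof.
by move=> a x y; rewrite -[x]proj_repr -[y]proj_repr -projD -!proj_scale
  scalerDr projD.
Qed.
Fact quotm_scaleDl x : {morph quotm_scale^~ x : a b / a + b}.
Proof. by move=> a b; rewrite -[x]proj_repr -!proj_scale scalerDl projD. Qed.

HB.instance Definition _ := GRing.Zmodule_isLmodule.Build k quotm
  quotm_scaleA quotm_scale1 quotm_scaleDr quotm_scaleDl.

Fact proj_linear : linear proj.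
Proof. by move=> c x y; rewrite projD proj_scale. Qed.
HB.instance Definition _ := GRing.isLinear.Build k V quotm _ proj proj_linear.

Lemma lift_proj (W : lmodType k) (F : {linear V -> W}) x :
  (forall y, S y -> F y = 0) -> F (repr (proj x)) = F x.
Proof.
move=> FS; apply/eqP; rewrite -subr_eq0 -raddfB.
by apply/eqP/(span_ker FS)/repr_proj.
Qed.

End Quotient.

Section LinearExtension.
Variables (k : fieldType) (K : choiceType) (W : lmodType k) (f : K -> W).

Definition malg_lift (v : {malg k[K]}) : W := \sum_(m <- msupp v) v@_m *: f m.

Lemma malg_liftEw (D : {fset K}) v : (msupp v `<=` D)%fset ->
  malg_lift v = \sum_(m <- D) v@_m *: f m.
Proof.
move=> le; rewrite /malg_lift (big_fset_incl _ le) //= => x _ /mcoeff_outdom ->.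
by rewrite scale0r.
Qed.

Fact malg_lift_linear : linear malg_lift.
Proof.
move=> c u v; pose D := (msupp u `|` msupp v `|` msupp (c *: u + v))%fset.
rewrite !(@malg_liftEw D) /D.
- rewrite scaler_sumr -big_split /=; apply: eq_bigr => i _.
  by rewrite mcoeffD mcoeffZ scalerDl scalerA.
- by apply: fsubset_trans (fsubsetUl _ _); exact: fsubsetUr.
- by apply: fsubset_trans (fsubsetUl _ _); exact: fsubsetUl.
- exact: fsubsetUr.
Qed.
HB.instance Definition _ :=
  GRing.isLinear.Build k {malg k[K]} W _ malg_lift malg_lift_linear.

Lemma malg_liftU m : malg_lift << m >> = f m.
Proof.
by rewrite (@malg_liftEw [fset m]%fset) ?msuppU_le // big_seq_fset1 mcoeffUU
  scale1r.
Qed.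

End LinearExtension.

Lemma malgZU (k : fieldType) (K : choiceType) c (m : K) :
  c *: << m >> = << c *g m >> :> {malg k[K]}.
Proof. by apply/malgP => n; rewrite mcoeffZ !mcoeffU mulrnAr mulr1. Qed.

Lemma malg_ind (k : fieldType) (K : choiceType) (P : {malg k[K]} -> Prop) :
    (forall u v, P u -> P v -> P (u + v)) -> P 0 ->
    (forall c m, P (c *: << m >>)) ->
  forall v, P v.
Proof.
move=> PD P0 PU v; rewrite [v]monalgE; elim/big_ind: _ => // m _.
by rewrite -malgZU.
Qed.

Inductive tensor_rel (k : fieldType) (M N : lmodType k) :
  {malg k[(M * N)%type]} -> Prop :=
| TensorDl x x' y : tensor_rel (<< (x + x', y) >> - << (x, y) >> - << (x', y) >>)
| TensorDr x y y' : tensor_rel (<< (x, y + y') >> - << (x, y) >> - << (x, y') >>)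
| TensorZl c x y : tensor_rel (<< (c *: x, y) >> - c *: << (x, y) >>)
| TensorZr c x y : tensor_rel (<< (x, c *: y) >> - c *: << (x, y) >>).

Definition tensor (k : fieldType) (M N : lmodType k) :=
  quotm (@tensor_rel k M N).
HB.instance Definition _ (k : fieldType) (M N : lmodType k) :=
  GRing.Lmodule.on (tensor M N).

HB.lock Definition tens (k : fieldType) (M N : lmodType k) (x : M) (y : N)
  : tensor M N := proj (@tensor_rel k M N) << (x, y) >>.

Section Tensor.
Variables (k : fieldType) (M N : lmodType k).
Local Notation tens := (@tens k M N).

Let proj0 r : @tensor_rel k M N r -> proj (@tensor_rel k M N) r = 0.
Proof.
by move=> h; rewrite -(raddf0 (proj _)); apply/projP; rewrite subr0; exact: span_sub.
Qed.

Lemma tensDl x x' y : tens (x + x') y = tens x y + tens x' y.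
Proof.
apply/eqP; rewrite -subr_eq0 opprD addrA tens.unlock -!raddfB /=.
exact/eqP/proj0/TensorDl.
Qed.
Lemma tensDr x y y' : tens x (y + y') = tens x y + tens x y'.
Proof.
apply/eqP; rewrite -subr_eq0 opprD addrA tens.unlock -!raddfB /=.
exact/eqP/proj0/TensorDr.
Qed.
Lemma tensZl c x y : tens (c *: x) y = c *: tens x y.
Proof.
apply/eqP; rewrite -subr_eq0 tens.unlock -linearZ -raddfB /=.
exact/eqP/proj0/TensorZl.
Qed.
Lemma tensZr c x y : tens x (c *: y) = c *: tens x y.
Proof.
apply/eqP; rewrite -subr_eq0 tens.unlock -linearZ -raddfB /=.
exact/eqP/proj0/TensorZr.
Qed.

Lemma tensor_ind (P : tensor M N -> Prop) :
    (forall s t, P s -> P t -> P (s + t)) -> (forall x y, P (tens x y)) ->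
  forall t, P t.
Proof.
move=> PD PT t; rewrite -[t]proj_repr.
have tE x y : proj (@tensor_rel k M N) << (x, y) >> = tens x y.
  by rewrite tens.unlock.
elim/malg_ind: (repr t) => [u v hu hv||c [x y]].
- by rewrite projD; exact: PD.
- have -> : (0 : {malg k[(M * N)%type]}) = 0 *: << (0 : M, 0 : N) >>.
    by rewrite scale0r.
  by rewrite linearZ /= tE -tensZl.
- by rewrite linearZ /= tE -tensZl.
Qed.

Definition bilinear2 (W : lmodType k) (f : M -> N -> W) :=
  (forall y, linear (f^~ y)) /\ (forall x, linear (f x)).

(* The factorization through [tensor M N]; meaningful for bilinear [f]. *)
Definition tensor_lift (W : lmodType k) (f : M -> N -> W) (t : tensor M N) : W :=
  malg_lift (fun p => f p.1 p.2) (repr t).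

Section Lift.
Variables (W : lmodType k) (f : M -> N -> W).
Hypothesis fP : bilinear2 f.

Let fDl x x' y : f (x + x') y = f x y + f x' y.
Proof. by have := fP.1 y 1 x x'; rewrite !scale1r. Qed.
Let fDr x y y' : f x (y + y') = f x y + f x y'.
Proof. by have := fP.2 x 1 y y'; rewrite !scale1r. Qed.
Let f0l y : f 0 y = 0.
Proof. by apply: (addrI (f 0 y)); rewrite -fDl !addr0. Qed.
Let f0r x : f x 0 = 0.
Proof. by apply: (addrI (f x 0)); rewrite -fDr !addr0. Qed.
Let fZl c x y : f (c *: x) y = c *: f x y.
Proof. by have := fP.1 y c x 0; rewrite f0l !addr0. Qed.
Let fZr c x y : f x (c *: y) = c *: f x y.
Proof. by have := fP.2 x c y 0; rewrite f0r !addr0. Qed.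

Let lift_rel (r : {malg k[(M * N)%type]}) :
  tensor_rel r -> malg_lift (fun p => f p.1 p.2) r = 0.
Proof.
case=> *; rewrite !linearB /=.
- by rewrite !malg_liftU /= fDl -addrA -opprD subrr.
- by rewrite !malg_liftU /= fDr -addrA -opprD subrr.
- by rewrite linearZ_LR /= !malg_liftU /= fZl subrr.
- by rewrite linearZ_LR /= !malg_liftU /= fZr subrr.
Qed.

Lemma tensor_liftE x y : tensor_lift f (tens x y) = f x y.
Proof. by rewrite /tensor_lift tens.unlock lift_proj //= malg_liftU. Qed.

Lemma tensor_lift_linear : linear (tensor_lift f).
Proof.
move=> c s t.
have h : proj _ (c *: repr s + repr t) = c *: s + t.
  by rewrite linearP /= !proj_repr.
by rewrite -[in LHS]h /tensor_lift lift_proj //= linearP.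
Qed.

Lemma tensor_liftD s t : tensor_lift f (s + t) = tensor_lift f s + tensor_lift f t.
Proof. by have := tensor_lift_linear 1 s t; rewrite !scale1r. Qed.
End Lift.

Lemma tensor_lift_add (W : lmodType k) (f g h : M -> N -> W) t c :
  bilinear2 f -> bilinear2 g -> bilinear2 h ->
  (forall x y, h x y = c *: f x y + g x y) ->
  tensor_lift h t = c *: tensor_lift f t + tensor_lift g t.
Proof.
move=> fP gP hP e; elim/tensor_ind: t => [s t hs ht|x y].
  by rewrite !tensor_liftD // hs ht scalerDr addrACA.
by rewrite !tensor_liftE.
Qed.

End Tensor.

HB.lock Definition tensor_lift2 (k : fieldType) (M N M' N' W : lmodType k)
    (f : M -> N -> M' -> N' -> W) (s : tensor M N) (t : tensor M' N') : W :=
  tensor_lift (fun x y => tensor_lift (f x y) t) s.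

Section Lift2.
Variables (k : fieldType) (M N M' N' W : lmodType k).
Variable f : M -> N -> M' -> N' -> W.
Hypothesis f1 : forall x' y', bilinear2 (fun x y => f x y x' y').
Hypothesis f2 : forall x y, bilinear2 (f x y).

Local Notation tensor_lift2 := (tensor_lift2 f).

Let inner t : bilinear2 (fun x y => tensor_lift (f x y) t).
Proof.
by split=> [y c x x'|x c y y']; apply: tensor_lift_add => // u v;
  [have [h _] := f1 u v | have [_ h] := f1 u v]; exact: h.
Qed.

Lemma tensor_lift2E x y x' y' :
  tensor_lift2 (tens x y) (tens x' y') = f x y x' y'.
Proof. by rewrite tensor_lift2.unlock tensor_liftE // tensor_liftE. Qed.

Lemma tensor_lift2P : bilinear2 tensor_lift2.
Proof.
rewrite tensor_lift2.unlock; split=> [t|s c t t']; first exact: tensor_lift_linear.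
apply: tensor_lift_add => // x y; exact: tensor_lift_linear.
Qed.

Lemma tensor_lift2Dl s s' t :
  tensor_lift2 (s + s') t = tensor_lift2 s t + tensor_lift2 s' t.
Proof. by have := tensor_lift2P.1 t 1 s s'; rewrite !scale1r. Qed.
Lemma tensor_lift2Dr s t t' :
  tensor_lift2 s (t + t') = tensor_lift2 s t + tensor_lift2 s t'.
Proof. by have := tensor_lift2P.2 s 1 t t'; rewrite !scale1r. Qed.
End Lift2.

Section TensorRing.
Variables (k : fieldType) (A B : algType k).

Let mulf (a : A) (b : B) a' b' := tens (a * a') (b * b').
Let mulf1 x' y' : bilinear2 (fun x y => mulf x y x' y').
Proof.
by split=> [y c x x''|x c y y'']; rewrite /mulf mulrDl -scalerAl
  ?tensDl ?tensDr ?tensZl ?tensZr.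
Qed.
Let mulf2 x y : bilinear2 (mulf x y).
Proof.
by split=> [y' c x' x''|x' c y' y'']; rewrite /mulf mulrDr -scalerAr
  ?tensDl ?tensDr ?tensZl ?tensZr.
Qed.

Definition tensor_mul : tensor A B -> tensor A B -> tensor A B :=
  tensor_lift2 (fun (a : A) (b : B) a' b' => tens (a * a') (b * b')).

Let tmulE a b a' b' : tensor_mul (tens a b) (tens a' b') = tens (a * a') (b * b').
Proof. exact: (tensor_lift2E mulf1 mulf2). Qed.
Let tmulDl : left_distributive tensor_mul +%R.
Proof. by move=> x y z; exact: (tensor_lift2Dl mulf1 mulf2). Qed.
Let tmulDr : right_distributive tensor_mul +%R.
Proof. by move=> x y z; exact: (tensor_lift2Dr mulf1 mulf2). Qed.
Let tmulA : associative tensor_mul.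
Proof.
move=> x y z; elim/tensor_ind: x => [s t hs ht|a b].
  by rewrite !tmulDl hs ht.
elim/tensor_ind: y => [s t hs ht|a' b'].
  by rewrite tmulDl !tmulDr tmulDl hs ht.
elim/tensor_ind: z => [s t hs ht|a'' b''].
  by rewrite !tmulDr hs ht.
by rewrite !tmulE !mulrA.
Qed.
Let tmul1x : left_id (tens 1 1) tensor_mul.
Proof.
move=> x; elim/tensor_ind: x => [s t hs ht|a b]; first by rewrite tmulDr hs ht.
by rewrite tmulE !mul1r.
Qed.
Let tmulx1 : right_id (tens 1 1) tensor_mul.
Proof.
move=> x; elim/tensor_ind: x => [s t hs ht|a b]; first by rewrite tmulDl hs ht.
by rewrite tmulE !mulr1.
Qed.

HB.instance Definition _ := GRing.Zmodule_isPzRing.Build (tensor A B)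
  tmulA tmul1x tmulx1 tmulDl tmulDr.

Lemma tens11 : tens (1 : A) (1 : B) = 1. Proof. by []. Qed.
Lemma tensM a b a' b' : tens (a : A) (b : B) * tens a' b' = tens (a * a') (b * b').
Proof. exact: tmulE. Qed.
Lemma tensor_scalerAl c (x y : tensor A B) : c *: (x * y) = (c *: x) * y.
Proof.
elim/tensor_ind: x => [s t hs ht|a b]; first by rewrite mulrDl !scalerDr mulrDl hs ht.
elim/tensor_ind: y => [s t hs ht|a' b']; first by rewrite !mulrDr scalerDr hs ht.
by rewrite -tensZl !tensM -tensZl scalerAl.
Qed.
Lemma tensor_scalerAr c (x y : tensor A B) : c *: (x * y) = x * (c *: y).
Proof.
elim/tensor_ind: x => [s t hs ht|a b]; first by rewrite !mulrDl scalerDr hs ht.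
elim/tensor_ind: y => [s t hs ht|a' b'].
  by rewrite mulrDr !scalerDr mulrDr hs ht.
by rewrite -tensZl !tensM -tensZl scalerAr.
Qed.
End TensorRing.

Lemma cross_cancel (V : zmodType) (a a' b b' m n : V) :
  (a - a') + (b - b') = (a + m) + (n + b) - ((a' + n) + (m + b')).
Proof.
rewrite [n + b]addrC [a + m + _]addrACA [m + b']addrC [a' + n + _]addrACA.
by rewrite [n + m]addrC opprD [RHS]addrACA subrr addr0 opprD addrACA.
Qed.

Lemma tens_comm (k : fieldType) (A : algType k) (x y : A) :
  tens 1 (x * y - y * x) + tens (x * y - y * x) 1 =
  (tens 1 x + tens x 1) * (tens 1 y + tens y 1)
  - (tens 1 y + tens y 1) * (tens 1 x + tens x 1).
Proof.
rewrite 2!mulrDl 4!mulrDr 8!tensM !mul1r !mulr1.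
rewrite -(scaleN1r (y * x)) tensDl tensDr tensZl tensZr !scaleN1r.
exact: cross_cancel.
Qed.

HB.mixin Record Lmodule_isLie (k : fieldType) g of GRing.Lmodule k g := {
  lie : g -> g -> g;
  lie_linearl : forall y, linear (lie^~ y);
  lie_linearr : forall x, linear (lie x);
  liexx : forall x, lie x x = 0;
  lie_jacobi : forall x y z,
    lie x (lie y z) + lie y (lie z x) + lie z (lie x y) = 0
}.

#[short(type="lieAlgType")]
HB.structure Definition LieAlgebra (k : fieldType) :=
  {g of GRing.Lmodule k g & Lmodule_isLie k g}.

(* g = \bigoplus_(n >= 1) g_n with dim g_n finite; [gr n] is the subspace g_n. *)
HB.mixin Record Lie_isGraded (k : fieldType) g of LieAlgebra k g := {
  gr : nat -> g -> Prop;
  gr_fin_dim : forall n, exists (m : nat) (b : 'I_m -> g),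
    forall x, gr n x <-> exists c : 'I_m -> k, x = \sum_(i < m) c i *: b i;
  gr_pos : forall x, gr 0%N x -> x = 0;
  gr_lie : forall n m x y, gr n x -> gr m y -> gr (n + m)%N (lie x y);
  gr_total : forall x, exists (N : nat) (f : nat -> g),
    (forall n, gr n (f n)) /\ x = \sum_(n < N) f n;
  gr_direct : forall (N : nat) (f : nat -> g), (forall n, gr n (f n)) ->
    \sum_(n < N) f n = 0 -> forall n : 'I_N, f n = 0
}.

#[short(type="gradedLieAlgType")]
HB.structure Definition GradedLieAlgebra (k : fieldType) :=
  {g of LieAlgebra k g & Lie_isGraded k g}.

Section LieTheory.
Variables (k : fieldType) (g : lieAlgType k).
Implicit Types x y z : g.

Lemma lieDl x y z : lie (x + y) z = lie x z + lie y z.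
Proof. by have := lie_linearl z 1 x y; rewrite !scale1r. Qed.
Lemma lieDr x y z : lie x (y + z) = lie x y + lie x z.
Proof. by have := lie_linearr x 1 y z; rewrite !scale1r. Qed.
Lemma lieC x y : lie x y = - lie y x.
Proof.
apply/eqP; rewrite -addr_eq0.
by have /eqP := liexx (x + y); rewrite lieDl !lieDr !liexx add0r addr0.
Qed.
End LieTheory.

Section CurrentAlgebra.
Variables (k : fieldType) (A : comAlgType k) (g : lieAlgType k).

Let lief (a : A) (u : g) b v := tens (a * b) (lie u v).
Let lief1 x' y' : bilinear2 (fun x y => lief x y x' y').
Proof.
split=> [y c x x''|x c y y'']; rewrite /lief.
  by rewrite mulrDl -scalerAl tensDl tensZl.
by rewrite lie_linearl tensDr tensZr.
Qed.
Let lief2 x y : bilinear2 (lief x y).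
Proof.
split=> [y' c x' x''|x' c y' y'']; rewrite /lief.
  by rewrite mulrDr -scalerAr tensDl tensZl.
by rewrite lie_linearr tensDr tensZr.
Qed.

Definition tensor_lie : tensor A g -> tensor A g -> tensor A g :=
  tensor_lift2 (fun (a : A) (u : g) b v => tens (a * b) (lie u v)).

Let tlieE a u b v : tensor_lie (tens a u) (tens b v) = tens (a * b) (lie u v).
Proof. exact: (tensor_lift2E lief1 lief2). Qed.
Let tlieDl x y z : tensor_lie (x + y) z = tensor_lie x z + tensor_lie y z.
Proof. exact: (tensor_lift2Dl lief1 lief2). Qed.
Let tlieDr x y z : tensor_lie x (y + z) = tensor_lie x y + tensor_lie x z.
Proof. exact: (tensor_lift2Dr lief1 lief2). Qed.
Let tlie_linl y : linear (tensor_lie^~ y).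
Proof. exact: (tensor_lift2P lief1 lief2).1. Qed.
Let tlie_linr x : linear (tensor_lie x).
Proof. exact: (tensor_lift2P lief1 lief2).2. Qed.

Let tensN (a : A) (u : g) : tens a (- u) = - tens a u.
Proof. by rewrite -scaleN1r tensZr scaleN1r. Qed.
Let tens0 (a : A) : tens a (0 : g) = 0.
Proof. by rewrite -(scale0r (0 : g)) tensZr scale0r. Qed.

Let tlie_anti x y : tensor_lie x y + tensor_lie y x = 0.
Proof.
elim/tensor_ind: x => [s t hs ht|a u].
  by rewrite tlieDl tlieDr addrACA hs ht addr0.
elim/tensor_ind: y => [s t hs ht|b v].
  by rewrite tlieDl tlieDr addrACA hs ht addr0.
by rewrite !tlieE [b * a]mulrC [lie v u]lieC tensN subrr.
Qed.
Let tliexx x : tensor_lie x x = 0.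
Proof.
elim/tensor_ind: x => [s t hs ht|a u]; last by rewrite tlieE liexx tens0.
by rewrite tlieDl !tlieDr hs ht add0r addr0 tlie_anti.
Qed.
Let tlie_jacobi x y z : tensor_lie x (tensor_lie y z)
  + tensor_lie y (tensor_lie z x) + tensor_lie z (tensor_lie x y) = 0.
Proof.
have aux (p q r p' q' r' : tensor A g) : p + q + r = 0 -> p' + q' + r' = 0 ->
    (p + p') + (q + q') + (r + r') = 0.
  by move=> h h'; rewrite [p + p' + (q + q')]addrACA [LHS]addrACA h h' addr0.
elim/tensor_ind: x => [s t hs ht|a u].
  by rewrite !(tlieDl, tlieDr); exact: aux.
elim/tensor_ind: y => [s t hs ht|b v].
  by rewrite !(tlieDl, tlieDr); exact: aux.
elim/tensor_ind: z => [s t hs ht|c w].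
  by rewrite !(tlieDl, tlieDr); exact: aux.
rewrite !tlieE [c * a]mulrC [b * (a * c)]mulrCA [c * (a * b)]mulrCA [c * b]mulrC.
by rewrite -!tensDr lie_jacobi tens0.
Qed.

HB.instance Definition _ := Lmodule_isLie.Build k (tensor A g)
  tlie_linl tlie_linr tliexx tlie_jacobi.

Lemma tens_lie (a b : A) (u v : g) :
  lie (tens a u) (tens b v) = tens (a * b) (lie u v).
Proof. exact: tlieE. Qed.
End CurrentAlgebra.

Lemma alg_scalerAr (k : pzRingType) (B : lalgType k) c (x y : B) :
  c%:A * x = x * c%:A -> c *: (x * y) = x * (c *: y).
Proof. by move=> h; rewrite -mulr_algl mulrA h -mulrA mulr_algl. Qed.

Lemma mulr5A (R : pzRingType) (a b c d e : R) :
  a * (b * c * d) * e = (a * b) * c * (d * e).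
Proof. by rewrite !mulrA. Qed.

Lemma linear_mul_ext (k : fieldType) (B : algType k) (W : lmodType k)
    (L : {linear B -> W}) (T : Type) (w : seq T -> B) (mul : W -> W -> W) :
    (forall s t, w (s ++ t) = w s * w t) ->
    (forall P : B -> Prop, (forall u v, P u -> P v -> P (u + v)) ->
      (forall c s, P (c *: w s)) -> forall v, P v) ->
    (forall x, linear (mul x)) -> (forall y, linear (mul^~ y)) ->
    (forall s t, L (w (s ++ t)) = mul (L (w s)) (L (w t))) ->
  forall u v, L (u * v) = mul (L u) (L v).
Proof.
move=> wM ind mulr mull LM u v.
have mD x y z : mul x (y + z) = mul x y + mul x z.
  by have := mulr x 1 y z; rewrite !scale1r.
have mDl x y z : mul (x + y) z = mul x z + mul y z.
  by have := mull z 1 x y; rewrite !scale1r.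
have m0r x : mul x 0 = 0 by apply: (addrI (mul x 0)); rewrite -mD !addr0.
have m0l x : mul 0 x = 0 by apply: (addrI (mul 0 x)); rewrite -mDl !addr0.
have mZ c x y : mul x (c *: y) = c *: mul x y.
  by have := mulr x c y 0; rewrite m0r !addr0.
have mZl c x y : mul (c *: x) y = c *: mul x y.
  by have := mull y c x 0; rewrite m0l !addr0.
elim/ind: u => [u u' hu hu'|c s]; first by rewrite mulrDl !linearD hu hu' mDl.
elim/ind: v => [v v' hv hv'|c' t]; first by rewrite mulrDr !linearD hv hv' mD.
by rewrite -scalerAl -scalerAr -wM !linearZ LM /= mZl mZ.
Qed.

(* Product of the dual numbers B[e]/(e^2), with (b, b') standing for b + b' e. *)
Section DualNumbers.
Variables (k : fieldType) (B : algType k).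
Definition dual_mul (p q : B * B) : B * B := (p.1 * q.1, p.2 * q.1 + p.1 * q.2).

Lemma dual_mul_linearr p : linear (dual_mul p).
Proof.
move=> c q r.
change ((p.1 * (c *: q.1 + r.1), p.2 * (c *: q.1 + r.1) + p.1 * (c *: q.2 + r.2))
  = (c *: (p.1 * q.1) + p.1 * r.1,
     c *: (p.2 * q.1 + p.1 * q.2) + (p.2 * r.1 + p.1 * r.2))).
by rewrite !mulrDr -!scalerAr scalerDr addrACA.
Qed.

Lemma dual_mul_linearl p : linear (dual_mul^~ p).
Proof.
move=> c q r.
change (((c *: q.1 + r.1) * p.1, (c *: q.2 + r.2) * p.1 + (c *: q.1 + r.1) * p.2)
  = (c *: (q.1 * p.1) + r.1 * p.1,
     c *: (q.2 * p.1 + q.1 * p.2) + (r.2 * p.1 + r.1 * p.2))).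
by rewrite !mulrDl -!scalerAl scalerDr addrACA.
Qed.
End DualNumbers.

Definition freealg (k : fieldType) (T : choiceType) : Type :=
  {malg k[{fmonom T}]}.

Section FreeAlgebra.
Variables (k : fieldType) (T : choiceType).

HB.instance Definition _ := GRing.Lalgebra.on (freealg k T).

Fact freealg_scalerAr c (x y : freealg k T) : c *: (x * y) = x * (c *: y).
Proof.
have comm : << c *g mone >> * x = x * << c *g mone >>.
  elim/malg_ind: x => [u v hu hv||a m].
  - by rewrite mulrDl mulrDr hu hv.
  - by rewrite mul0r mulr0.
  - rewrite malgZU.
    by rewrite !malgM_def !fgmulUU mulm1 mul1m mulrC.
apply: alg_scalerAr; rewrite -malgZU in comm; exact: comm.
Qed.
HB.instance Definition _ :=
  GRing.Lalgebra_isAlgebra.Build k (freealg k T) freealg_scalerAr.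
End FreeAlgebra.

HB.lock Definition gen (k : fieldType) (T : choiceType) (x : T) : freealg k T :=
  << fmu x >>.

HB.lock Definition freealg_lift (k : fieldType) (T : choiceType) (W : lmodType k)
  (f : seq T -> W) (v : freealg k T) : W := malg_lift (fun m : {fmonom T} => f m) v.

Section FreeAlgebraTheory.
Variables (k : fieldType) (T : choiceType).
Local Notation F := (freealg k T).
Local Notation gen := (@gen k T).

Lemma word_malg (s : seq T) : \prod_(x <- s) gen x = << FMonom s >>.
Proof.
elim: s => [|x s IH].
  rewrite big_nil -[LHS]/(<< mone >> : {malg k[{fmonom T}]}).
  by congr (<< _ >>); apply/val_inj; rewrite /= fm1.
rewrite big_cons IH gen.unlock malgM_def fgmulUU mulr1.
by congr (<< _ >>); apply/val_inj; rewrite /= fmM fmU.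
Qed.

Lemma freealg_ind (P : F -> Prop) :
    (forall u v, P u -> P v -> P (u + v)) ->
    (forall c s, P (c *: \prod_(x <- s) gen x)) ->
  forall v, P v.
Proof.
move=> PD PW; apply: malg_ind => [||c [s]]; first exact: PD.
  by have := PW 0 [::]; rewrite scale0r.
by have := PW c s; rewrite word_malg.
Qed.

Fact freealg_lift_linear (W : lmodType k) (f : seq T -> W) :
  linear (freealg_lift f : F -> W).
Proof. by rewrite freealg_lift.unlock => c u v; exact: malg_lift_linear. Qed.
HB.instance Definition _ (W : lmodType k) (f : seq T -> W) :=
  GRing.isLinear.Build k F W _ (freealg_lift f) (freealg_lift_linear f).

Lemma freealg_lift_word (W : lmodType k) (f : seq T -> W) s :
  freealg_lift f (\prod_(x <- s) gen x) = f s.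
Proof. by rewrite freealg_lift.unlock word_malg malg_liftU. Qed.

Lemma freealg_lift_gen (W : lmodType k) (f : seq T -> W) x :
  freealg_lift f (gen x) = f [:: x].
Proof. by rewrite -(freealg_lift_word f [:: x]) big_seq1. Qed.

Lemma freealg_lift2 (W : lmodType k) (f : seq T -> W) x y :
  freealg_lift f (gen x * gen y) = f [:: x; y].
Proof. by rewrite -(freealg_lift_word f [:: x; y]) big_cons big_seq1. Qed.

Lemma freealg_liftM (W : lmodType k) (f : seq T -> W) (mul : W -> W -> W) u v :
    (forall x, linear (mul x)) -> (forall y, linear (mul^~ y)) ->
    (forall s t, f (s ++ t) = mul (f s) (f t)) ->
  freealg_lift f (u * v : F) = mul (freealg_lift f u) (freealg_lift f v).
Proof.
move=> mulr mull fM.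
apply: (@linear_mul_ext k F W (freealg_lift f) T
  (fun s => \prod_(x <- s) gen x)) => //.
- by move=> s t; exact: big_cat.
- exact: freealg_ind.
- move=> s t /=; rewrite !freealg_lift_word; exact: fM.
Qed.

End FreeAlgebraTheory.

Inductive env_rel (k : fieldType) (g : lieAlgType k) : freealg k g -> Prop :=
| EnvD x y : env_rel (gen k (x + y) - gen k x - gen k y)
| EnvZ c x : env_rel (gen k (c *: x) - c *: gen k x)
| EnvLie x y : env_rel (gen k x * gen k y - gen k y * gen k x - gen k (lie x y)).

(* The span of these elements is the two-sided ideal generated by [env_rel]. *)
Definition env_ideal (k : fieldType) (g : lieAlgType k) (r : freealg k g) :=
  exists a s b, env_rel s /\ r = a * s * b.

Definition env (k : fieldType) (g : lieAlgType k) := quotm (@env_ideal k g).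
HB.instance Definition _ (k : fieldType) (g : lieAlgType k) :=
  GRing.Lmodule.on (env g).

HB.lock Definition env_mul (k : fieldType) (g : lieAlgType k) (x y : env g)
  : env g := proj (@env_ideal k g) (repr x * repr y).
HB.lock Definition env_one (k : fieldType) (g : lieAlgType k)
  : env g := proj (@env_ideal k g) 1.

Section Enveloping.
Variables (k : fieldType) (g : lieAlgType k).
Local Notation F := (freealg k g).
Local Notation I := (@env_ideal k g).
Local Notation pi := (proj I).

Lemma env_idealM (a b s : F) : span I s -> span I (a * s * b).
Proof.
elim=> [|x y _ hx _ hy|c x [a' [r [b' [hr ->]]]]].
- by rewrite mulr0 mul0r; exact: span0.
- by rewrite mulrDr mulrDl; exact: spanD.
- rewrite -scalerAr -scalerAl; apply: spanZ.
  exists (a * a'), r, (b' * b); split; [exact: hr|apply: mulr5A].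
Qed.

Lemma env_rel_ideal s : env_rel s -> I s.
Proof. by move=> h; exists 1, s, 1; rewrite mul1r mulr1. Qed.

Lemma proj_env_rel s : env_rel s -> pi s = 0.
Proof.
move=> h; rewrite -(linear0 pi); apply/projP; rewrite subr0.
exact/span_sub/env_rel_ideal.
Qed.

Local Notation env_mul := (@env_mul k g).
Local Notation env_one := (@env_one k g).

Lemma proj_mul (x y : F) : pi (x * y) = env_mul (pi x) (pi y).
Proof.
rewrite env_mul.unlock; apply/projP.
have -> : x * y - repr (pi x) * repr (pi y) =
    1 * (x - repr (pi x)) * y + repr (pi x) * (y - repr (pi y)) * 1.
  by rewrite mul1r mulr1 mulrBl mulrBr addrA subrK.
by apply: spanD; apply: env_idealM; apply/projP; rewrite proj_repr.
Qed.

Let umulA : associative env_mul.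
Proof.
move=> x y z; rewrite -[x]proj_repr -[y]proj_repr -[z]proj_repr.
by rewrite -!proj_mul mulrA.
Qed.
Let umul1x : left_id env_one env_mul.
Proof. by move=> x; rewrite -[x]proj_repr env_one.unlock -proj_mul mul1r. Qed.
Let umulx1 : right_id env_one env_mul.
Proof. by move=> x; rewrite -[x]proj_repr env_one.unlock -proj_mul mulr1. Qed.
Let umulDl : left_distributive env_mul +%R.
Proof.
move=> x y z; rewrite -[x]proj_repr -[y]proj_repr -[z]proj_repr.
by rewrite -projD -!proj_mul mulrDl projD.
Qed.
Let umulDr : right_distributive env_mul +%R.
Proof.
move=> x y z; rewrite -[x]proj_repr -[y]proj_repr -[z]proj_repr.
by rewrite -projD -!proj_mul mulrDr projD.
Qed.
Let umul1_neq0 : env_one != 0.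
Proof.
rewrite env_one.unlock -(linear0 pi); apply/eqP => /projP; rewrite subr0 => h.
pose aug : F -> k^o := freealg_lift (fun s => (nilp s)%:R).
have augM (u v : F) : aug (u * v) = aug u * aug v.
  apply: freealg_liftM => [x|y|s t].
  - by move=> c' y z; rewrite mulrDr scalerAr.
  - by move=> c' x z; rewrite mulrDl scalerAl.
  - by rewrite /nilp size_cat addn_eq0; case: eqP; case: eqP;
      rewrite ?mulr0 ?mulr1 ?mul0r.
suff : aug 1 = 0.
  rewrite /aug; have := freealg_lift_word (fun s : seq g => (nilp s)%:R : k^o) [::].
  by rewrite big_nil => -> /eqP; rewrite oner_eq0.
elim: h => [|x y _ hx _ hy|c x [a [r [b [hr ->]]]]].
- exact: linear0.
- by rewrite /aug linearD /= -/aug hx hy addr0.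
rewrite /aug linearZ /= -/aug !augM.
suff -> : aug r = 0 by rewrite mulr0 mul0r scaler0.
have a1 y : aug (gen k y) = 0 by rewrite /aug freealg_lift_gen.
have a2 y z : aug (gen k y * gen k z) = 0 by rewrite /aug freealg_lift2.
case: hr => [y z|c' y|y z].
- by rewrite /aug 2!linearB /= -/aug !a1 !subr0.
- by rewrite /aug linearB linearZ /= -/aug !a1 scaler0 subr0.
- by apply: linear_eq0B; [apply: a2|apply: a2|apply: a1].
Qed.
Let umul_scalerAl c x y : c *: env_mul x y = env_mul (c *: x) y.
Proof.
rewrite -[x]proj_repr -[y]proj_repr.
have Z v : c *: pi v = pi (c *: v) by rewrite linearZ.
by rewrite -proj_mul !Z -proj_mul scalerAl.
Qed.
Let umul_scalerAr c x y : c *: env_mul x y = env_mul x (c *: y).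
Proof.
rewrite -[x]proj_repr -[y]proj_repr.
have Z v : c *: pi v = pi (c *: v) by rewrite linearZ.
by rewrite -proj_mul !Z -proj_mul scalerAr.
Qed.

HB.instance Definition _ := GRing.Zmodule_isNzRing.Build (env g)
  umulA umul1x umulx1 umulDl umulDr umul1_neq0.
HB.instance Definition _ := GRing.Lmodule_isLalgebra.Build k (env g) umul_scalerAl.
HB.instance Definition _ := GRing.Lalgebra_isAlgebra.Build k (env g) umul_scalerAr.

End Enveloping.

Section EnvelopingTheory.
Variables (k : fieldType) (g : lieAlgType k).
Local Notation F := (freealg k g).
Local Notation pi := (proj (@env_ideal k g) : F -> env g).

Definition env_in (x : g) : env g := pi (gen k x).

Lemma env_projM (x y : F) : pi (x * y) = pi x * pi y.
Proof. exact: proj_mul. Qed.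
Lemma env_proj1 : pi 1 = 1.
Proof. by rewrite -[RHS]/(env_one g) env_one.unlock. Qed.

Lemma env_in_linear : linear env_in.
Proof.
move=> c x y.
have h1 := linear_eq0D (proj_env_rel (EnvD (c *: x) y)).
have h2 := linear_eq0Z (proj_env_rel (EnvZ c x)).
exact: etrans h1 (congr1 (fun z => z + env_in y) h2).
Qed.

Lemma env_in_lie x y : env_in (lie x y) = env_in x * env_in y - env_in y * env_in x.
Proof.
have h := linear_eq0L (proj_env_rel (EnvLie x y)).
exact: etrans h (congr2 (fun a b => a - b) (env_projM _ _) (env_projM _ _)).
Qed.

(* The algebra map with x |-> 1 (x) x + x (x) 1. *)
Definition coproduct (u : env g) : tensor (env g) (env g) :=
  freealg_lift (fun s : seq g =>
    \prod_(x <- s) (tens 1 (env_in x) + tens (env_in x) 1)) (repr u).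

(* The derivation of [env g] extending a derivation d of g:
   x_1 ... x_r |-> \sum_i x_1 ... d(x_i) ... x_r. *)
Fixpoint word_der (d : g -> g) (s : seq g) : env g :=
  if s is x :: s' then
    env_in (d x) * \prod_(y <- s') env_in y + env_in x * word_der d s'
  else 0.

Definition env_der (d : g -> g) (u : env g) : env g :=
  freealg_lift (word_der d) (repr u).

Lemma env_inD x y : env_in (x + y) = env_in x + env_in y.
Proof. by have := env_in_linear 1 x y; rewrite !scale1r. Qed.
Lemma env_in0 : env_in 0 = 0.
Proof. by apply: (addrI (env_in 0)); rewrite -env_inD !addr0. Qed.
Lemma env_inZ c x : env_in (c *: x) = c *: env_in x.
Proof. by have := env_in_linear c x 0; rewrite env_in0 !addr0. Qed.

Lemma env_proj_word s : pi (\prod_(x <- s) gen k x) = \prod_(x <- s) env_in x.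
Proof.
elim: s => [|x s IH]; first by rewrite !big_nil env_proj1.
rewrite !big_cons -IH; exact: env_projM.
Qed.

Lemma env_ind (P : env g -> Prop) :
    (forall u v, P u -> P v -> P (u + v)) ->
    (forall c s, P (c *: \prod_(x <- s) env_in x)) ->
  forall u, P u.
Proof.
move=> PD PW u; rewrite -[u]proj_repr; elim/freealg_ind: (repr u) => [a b ha hb|c s].
  by rewrite projD; exact: PD.
have -> : pi (c *: \prod_(x <- s) gen k x) = c *: \prod_(x <- s) env_in x.
  by rewrite -env_proj_word; exact: linearZ.
exact: PW.
Qed.

Let h x : tensor (env g) (env g) := tens 1 (env_in x) + tens (env_in x) 1.
Let hD x y : h (x + y) = h x + h y.
Proof. by rewrite /h env_inD tensDl tensDr addrACA. Qed.
Let hZ c x : h (c *: x) = c *: h x.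
Proof. by rewrite /h env_inZ tensZl tensZr scalerDr. Qed.
Let hL x y : h (lie x y) = h x * h y - h y * h x.
Proof.
rewrite /h env_in_lie; exact: tens_comm.
Qed.

Let C : {linear F -> tensor (env g) (env g)} := freealg_lift (fun s : seq g => \prod_(x <- s) h x).
Let CM (u v : F) : C (u * v) = C u * C v.
Proof.
rewrite /C; apply: (@freealg_liftM k g (tensor (env g) (env g))
  (fun s => \prod_(x <- s) h x) (fun a b : tensor (env g) (env g) => a * b)) => [x|y|s t]; last exact: big_cat.
- by move=> c y z; rewrite mulrDr tensor_scalerAr.
- by move=> c x z; rewrite mulrDl tensor_scalerAl.
Qed.
Let Cgen x : C (gen k x) = h x.
Proof. by apply: etrans (freealg_lift_gen _ x) _; rewrite big_seq1. Qed.
Let C_rel s : env_rel s -> C s = 0.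
Proof.
case=> [x y|c x|x y].
- apply: (@linear_eqD _ _ _ C).
  by rewrite (Cgen (x + y)) (Cgen x) (Cgen y) hD.
- by apply: (@linear_eqZ _ _ _ C); rewrite (Cgen (c *: x)) (Cgen x) hZ.
- apply: (@linear_eqB _ _ _ C); rewrite (Cgen (lie x y)).
  have e a b : C (gen k a * gen k b) = h a * h b by rewrite CM !Cgen.
  rewrite hL; exact: (esym (congr2 (fun a b => a - b) (e x y) (e y x))).
Qed.
Let C_proj v : coproduct (pi v) = C v.
Proof.
apply: lift_proj => _ [a [s [b [hs ->]]]] /=.
by rewrite -[LHS]/(C _) (CM (a * s) b) (CM a s) (C_rel hs) mulr0 mul0r.
Qed.

Lemma coproduct_linear : linear coproduct.
Proof.
move=> c u v.
have E w : coproduct w = C (repr w) by rewrite -[in LHS](proj_repr w) C_proj.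
have -> : coproduct (c *: u + v) = C (c *: repr u + repr v).
  by rewrite -C_proj linearP /= !proj_repr.
rewrite (E u) (E v); exact: freealg_lift_linear.
Qed.
Lemma coproduct1 : coproduct 1 = 1.
Proof.
rewrite -env_proj1 C_proj; have := freealg_lift_word (fun s : seq g => \prod_(x <- s) h x) [::].
by rewrite !big_nil.
Qed.
Lemma coproductM u v : coproduct (u * v) = coproduct u * coproduct v.
Proof.
by rewrite -[u]proj_repr -[v]proj_repr -env_projM !C_proj CM.
Qed.
Lemma coproduct_in x : coproduct (env_in x) = tens 1 (env_in x) + tens (env_in x) 1.
Proof. by rewrite /env_in C_proj Cgen. Qed.

Section Derivation.
Variable d : {linear g -> g}.
Hypothesis dP : forall x y, d (lie x y) = lie (d x) y + lie x (d y).

Let D : {linear F -> env g} := freealg_lift (word_der d).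
Let W := (env g * env g)%type.
Let f s : W := (\prod_(x <- s) env_in x, word_der d s).
Let mul : W -> W -> W := @dual_mul k (env g).
Let fM s t : f (s ++ t) = mul (f s) (f t).
Proof.
rewrite /f /mul /dual_mul /= big_cat; congr (_, _); elim: s => [|x s IH] /=.
  by rewrite mul0r big_nil mul1r add0r.
by rewrite IH big_cat big_cons mulrDr !mulrDl !mulrA addrA.
Qed.
Let fE v : freealg_lift f v = (pi v, D v).
Proof.
elim/freealg_ind: v => [u v hu hv|c s].
  have -> : freealg_lift f (u + v) = freealg_lift f u + freealg_lift f v.
    exact: linearD.
  have -> : D (u + v) = D u + D v by exact: linearD.
  by rewrite hu hv projD.
set w := \prod_(x <- s) _.
have -> : freealg_lift f (c *: w) = c *: freealg_lift f w by exact: linearZ.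
have -> : D (c *: w) = c *: D w by exact: linearZ.
have -> : pi (c *: w) = c *: \prod_(x <- s) env_in x.
  by rewrite -env_proj_word; exact: linearZ.
have -> : D w = word_der d s by exact: freealg_lift_word.
by have -> : freealg_lift f w = f s by exact: freealg_lift_word.
Qed.
Let DM (u v : F) : D (u * v) = D u * pi v + pi u * D v.
Proof.
have mulr p : linear (mul p) by exact: dual_mul_linearr.
have mull p : linear (mul^~ p) by exact: dual_mul_linearl.
have e := congr1 snd (@freealg_liftM k g W f mul u v mulr mull fM).
by rewrite (fE (u * v)) (fE u) (fE v) in e.
Qed.
Let Dgen x : D (gen k x) = env_in (d x).
Proof.
apply: etrans (freealg_lift_gen _ x) _.
by rewrite /= big_nil mulr1 mulr0 addr0.
Qed.
Let D_rel s : env_rel s -> D s = 0.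
Proof.
case=> [x y|c x|x y].
- apply: (@linear_eqD _ _ _ D).
  by rewrite (Dgen (x + y)) (Dgen x) (Dgen y) linearD env_inD.
- by apply: (@linear_eqZ _ _ _ D); rewrite (Dgen (c *: x)) (Dgen x) linearZ env_inZ.
- apply: (@linear_eqB _ _ _ D); rewrite (Dgen (lie x y)).
  have e a b : D (gen k a * gen k b) = env_in (d a) * env_in b + env_in a * env_in (d b).
    by rewrite DM !Dgen.
  rewrite dP env_inD !env_in_lie.
  apply: etrans (esym (congr2 (fun a b => a - b) (e x y) (e y x))).
  by rewrite addrACA -opprD; congr (_ - _); rewrite addrC.
Qed.
Let D_proj v : env_der d (pi v) = D v.
Proof.
apply: lift_proj => _ [a [s [b [hs ->]]]] /=.
rewrite -[LHS]/(D _) (DM (a * s) b) (DM a s) (D_rel hs) (env_projM a s).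
rewrite [pi s](proj_env_rel hs).
by rewrite !(mulr0, mul0r, addr0).
Qed.

Lemma env_der_linear : linear (env_der d).
Proof.
move=> c u v.
have E w : env_der d w = D (repr w) by rewrite -[in LHS](proj_repr w) D_proj.
have -> : env_der d (c *: u + v) = D (c *: repr u + repr v).
  by rewrite -D_proj linearP /= !proj_repr.
rewrite (E u) (E v); exact: freealg_lift_linear.
Qed.
Lemma env_derM u v : env_der d (u * v) = env_der d u * v + u * env_der d v.
Proof.
by rewrite -[u]proj_repr -[v]proj_repr -env_projM !D_proj DM.
Qed.
Lemma env_der1 : env_der d 1 = 0.
Proof.
by have := freealg_lift_word (word_der d) [::]; rewrite big_nil -env_proj1 D_proj.
Qed.
Lemma env_der_in x : env_der d (env_in x) = env_in (d x).
Proof. by rewrite /env_in D_proj Dgen. Qed.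
End Derivation.

End EnvelopingTheory.

(* An element of the completion \prod_n M_n of a graded space M is encoded as a
   sequence in M whose n-th term is homogeneous of degree n. *)

Section Completion.
Variables (k : fieldType) (A : comAlgType k) (g : gradedLieAlgType k).
Local Notation L := (tensor A g).
Local Notation U := (env L).

(* L_n = A (x) g_n, as a subspace of A (x) g. *)
Definition cur_gr (n : nat) : L -> Prop :=
  span (fun t => exists (a : A) (u : g), gr n u /\ t = tens a u).

Inductive env_word : nat -> U -> Prop :=
| EnvWord0 : env_word 0%N 1
| EnvWordS n m x w :
    cur_gr n x -> env_word m w -> env_word (n + m)%N (env_in x * w).

(* U_n is spanned by the products x_1 ... x_r, x_i in L_(n_i), of total
   degree n; in particular U_0 = k.1 since L_0 = 0. *)
Definition env_gr (n : nat) : U -> Prop := span (env_word n).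

Definition prodL (l : nat -> L) : Prop := forall n, cur_gr n (l n).
Definition prodU (f : nat -> U) : Prop := forall n, env_gr n (f n).

Definition hone (n : nat) : U := (n == 0%N)%:R.
Definition hmul (f h : nat -> U) (n : nat) : U :=
  \sum_(i < n.+1) f i * h (n - i)%N.
Definition hin (l : nat -> L) (n : nat) : U := env_in (l n).

(* exp x = \sum_m x^m / m! for x without term of degree 0: then x^m has no term
   of degree < m, so that the degree n part only involves m <= n. *)
Definition hexp (f : nat -> U) (n : nat) : U :=
  \sum_(m < n.+1) (m`!%:R)^-1 *: iter m (hmul f) hone n.

(* phi <> 0 and \Delta phi = phi (x) phi, compared in each total degree of the
   completed tensor square of U. *)
Definition grouplike (phi : nat -> U) : Prop :=
  [/\ prodU phi, exists n, phi n != 0 &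
      forall n, coproduct (phi n) =
        \sum_(i < n.+1) tens (phi i) (phi (n - i)%N)].

(* A derivation acts componentwise on [prodL], hence is given by its restriction
   to the direct sum of the L_n; it is k-linear but need not be A-linear. *)
Definition derivation (d : {linear L -> L}) : Prop :=
  (forall n x, cur_gr n x -> cur_gr n (d x)) /\
  (forall x y, d (lie x y) = lie (d x) y + lie x (d y)).

Definition kerL (d : L -> L) (l : nat -> L) : Prop :=
  prodL l /\ forall n, d (l n) = 0.

Definition imL (d : L -> L) (l : nat -> L) : Prop :=
  exists2 l', prodL l' & forall n, l n = d (l' n).

Definition ker_im_direct_sum (d : L -> L) : Prop :=
  (forall l, prodL l -> exists a b,
     [/\ kerL d a, imL d b & forall n, l n = a n + b n]) /\
  (forall l, kerL d l -> imL d l -> forall n, l n = 0).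

Definition conjugate (d : L -> L) (u v : nat -> L) : Prop :=
  exists phi, grouplike phi /\
    forall n, env_der d (phi n) + hmul (hin v) phi n = hmul phi (hin u) n.

Definition exp_kerL (d : L -> L) (phi : nat -> U) : Prop :=
  exists x, kerL d x /\ forall n, phi n = hexp (hin x) n.

End Completion.

(* Main.v *)
From HB Require Import structures.
Require Import Defs.
From mathcomp Require Import all_boot all_algebra.
From mathcomp Require Import boolp.

Set Implicit Arguments.
Unset Strict Implicit.
Unset Printing Implicit Defensive.

Import GRing.Theory.
Local Open Scope ring_scope.

(** Throughout, E is the Euler derivation, multiplication by n in degree n; it is
    a derivation of L and of its completed enveloping algebra U, and injective
    on L because L has no component of degree 0 and the characteristic is 0.

    _Logarithmic derivatives._ Let T(x_1 ... x_r) = [x_1, [..., [x_(r-1), E x_r]]]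
    be the Dynkin operator from U to L; it is the orbit map of a representation
    of L on k + L, hence well defined on U. The derivation E of U is the
    convolution of T with the identity ([dynkin_convolution]), so that a
    group-like phi satisfies E phi = theta phi with theta = T phi a Lie series.
    Moreover T x = E x for x in L, which shows that L embeds in U
    ([env_in_eq0]). Conversely, a solution phi of E phi = theta phi with
    constant term 1 is group-like, since the coproduct of phi and phi (x) phi
    solve the same linear equation ([log_derivative_group_like]).

    _Exponentials._ With F(t) = (e^t - 1)/t, every derivation D of U satisfies
    D(e^x) = (F(ad x) (D x)) e^x ([derivation_exp]). For D = E this shows that
    e^x is group-like when x is in L. It also shows that a solution of
    E phi = theta phi is e^x as soon as F(ad x) (E x) = theta, an equation solved
    degree by degree inside any graded subalgebra that contains theta
    ([log_derivative_exp]).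

    _Existence._ For D f = f u - u f - d f the formula says that e^x conjugates u
    to v = u + F(ad x) ([x, u] - d x). The component v_n is -d x_n plus a term
    that involves only x_m for m < n, so that x_n can be chosen to cancel the
    part of that term lying in d(L) ([conj_to_ker]).

    _Uniqueness._ Conjugacy is an equivalence relation, so it suffices to see that
    d phi + v phi = phi w with v and w in the kernel of d forces phi to be in
    exp(ker d). By induction on n, d phi_n = 0: the degree n part of the equation
    gives d^2 phi_n = 0, and n phi_n = \sum_i theta_i phi_(n-i) gives
    n d phi_n = d theta_n, so that d theta_n belongs to the kernel and to the
    image of d ([conj_ker]). Then theta is in the kernel of d, hence so is x with
    phi = e^x. *)

(** * Sequences with the Cauchy product *)

(** An alias of [nat -> R], so that its product can be the Cauchy product rather
    than the pointwise one: [series R] is R[[t]], and on the completed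
    enveloping algebra [hmul] is its multiplication. *)
Definition series (R : Type) : Type := nat -> R.

HB.instance Definition _ (R : Type) := gen_eqMixin (series R).
HB.instance Definition _ (R : Type) := gen_choiceMixin (series R).

Section SeriesZmodule.
Variable V : zmodType.
Implicit Types f h : series V.

Definition series_add f h : series V := fun n => f n + h n.
Definition series_opp f : series V := fun n => - f n.
Definition series_zero : series V := fun=> 0.

Fact series_addA : associative series_add.
Proof. by move=> f h l; apply/funext => n; apply: addrA. Qed.
Fact series_addC : commutative series_add.
Proof. by move=> f h; apply/funext => n; apply: addrC. Qed.
Fact series_add0 : left_id series_zero series_add.
Proof. by move=> f; apply/funext => n; apply: add0r. Qed.
Fact series_addN : left_inverse series_zero series_opp series_add.
Proof. by move=> f; apply/funext => n; apply: addNr. Qed.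

HB.instance Definition _ := GRing.isZmodule.Build (series V)
  series_addA series_addC series_add0 series_addN.

Lemma seriesD f h n : (f + h) n = f n + h n. Proof. by []. Qed.
Lemma seriesN f n : (- f) n = - f n. Proof. by []. Qed.
Lemma series_sum I (r : seq I) (P : pred I) (F : I -> series V) n :
  (\sum_(i <- r | P i) F i) n = \sum_(i <- r | P i) F i n.
Proof. by elim/big_rec2: _ => // i x y _ <-. Qed.
End SeriesZmodule.

Section SeriesRing.
Variable R : pzRingType.
Implicit Types f h l : series R.

Definition series_mul f h : series R :=
  fun n => \sum_(i < n.+1) f i * h (n - i)%N.
Definition series_one : series R := fun n => (n == 0%N)%:R.

Fact series_mul_rev f h n :
  series_mul f h n = \sum_(i < n.+1) f (n - i)%N * h i.
Proof.
rewrite /series_mul (reindex_inj rev_ord_inj) /=.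
by apply: eq_bigr => i _; rewrite subSS subKn // -ltnS.
Qed.
(* Both sides are the sum of f_i h_j l_m over i + j + m = n, indexed by i and m. *)
Fact series_mulA : associative series_mul.
Proof.
move=> f h l; apply/funext => n; rewrite [RHS]series_mul_rev {1}/series_mul.
pose c i m := f i * (h (n - i - m)%N * l m).
transitivity (\sum_(i < n.+1) \sum_(m < n.+1 | (m <= n - i)%N) c i m).
  apply: eq_bigr => i _; rewrite series_mul_rev big_distrr /=.
  by rewrite (big_ord_narrow_leq (leq_subr i n)).
rewrite (exchange_big_dep xpredT) //=; apply: eq_bigr => m _.
rewrite big_distrl /=.
transitivity (\sum_(i < n.+1 | (i <= n - m)%N) c i m).
  by apply: eq_bigl => i /=; rewrite !leq_subRL ?leq_ord // addnC.
rewrite (big_ord_narrow_leq (leq_subr m n)) /=.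
by apply: eq_bigr => i _; rewrite /c subnAC mulrA.
Qed.
Fact series_mul1l : left_id series_one series_mul.
Proof.
move=> f; apply/funext => n; rewrite /series_mul big_ord_recl mul1r subn0.
by rewrite big1 ?addr0 // => i _; rewrite mul0r.
Qed.
Fact series_mul1r : right_id series_one series_mul.
Proof.
move=> f; apply/funext => n; rewrite /series_mul big_ord_recr /= subnn mulr1.
rewrite big1 ?add0r // => -[i /= lti] _.
by rewrite /series_one subn_eq0 leqNgt lti mulr0.
Qed.
Fact series_mulDl : left_distributive series_mul +%R.
Proof.
move=> f h l; apply/funext => n; rewrite seriesD -big_split /=.
by apply: eq_bigr => i _; apply: mulrDl.
Qed.
Fact series_mulDr : right_distributive series_mul +%R.
Proof.
move=> f h l; apply/funext => n; rewrite seriesD -big_split /=.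
by apply: eq_bigr => i _; apply: mulrDr.
Qed.

HB.instance Definition _ := GRing.Zmodule_isPzRing.Build (series R)
  series_mulA series_mul1l series_mul1r series_mulDl series_mulDr.

Lemma seriesM f h n : (f * h) n = \sum_(i < n.+1) f i * h (n - i)%N.
Proof. by []. Qed.
Lemma series1E n : (1 : series R) n = (n == 0%N)%:R.
Proof. by []. Qed.
Lemma seriesM0 f h : (f * h) 0%N = f 0%N * h 0%N.
Proof. by rewrite seriesM big_ord_recl big_ord0 addr0. Qed.
Lemma seriesM_recl f h n :
  (f * h) n = f 0%N * h n + \sum_(i < n) f i.+1 * h (n - i.+1)%N.
Proof. by rewrite seriesM big_ord_recl subn0. Qed.
Lemma seriesM_recr f h n :
  (f * h) n = \sum_(i < n) f i * h (n - i)%N + f n * h 0%N.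
Proof. by rewrite seriesM big_ord_recr /= subnn. Qed.
End SeriesRing.

(** * Linear functions given without a structure *)

Section PlainLinear.
Variables (k : pzRingType) (V W : lmodType k) (f : V -> W).
Hypothesis f_linear : linear f.

Lemma plain_linearD x y : f (x + y) = f x + f y.
Proof. by have := f_linear 1 x y; rewrite !scale1r. Qed.
Lemma plain_linear0 : f 0 = 0.
Proof. by apply: (addrI (f 0)); rewrite -plain_linearD !addr0. Qed.
Lemma plain_linearZ c x : f (c *: x) = c *: f x.
Proof. by have := f_linear c x 0; rewrite plain_linear0 !addr0. Qed.
Lemma plain_linearN x : f (- x) = - f x.
Proof. by rewrite -scaleN1r plain_linearZ scaleN1r. Qed.
Lemma plain_linear_sum I (r : seq I) (F : I -> V) :
  f (\sum_(i <- r) F i) = \sum_(i <- r) f (F i).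
Proof. exact: (big_morph f plain_linearD plain_linear0). Qed.
End PlainLinear.

(** * Families of series *)

Lemma sum_ord_tail0 (V : zmodType) (F : nat -> V) n m :
    (n <= m)%N -> (forall i, (n <= i < m)%N -> F i = 0) ->
  \sum_(i < m) F i = \sum_(i < n) F i.
Proof.
move=> le_nm F0; rewrite -!(big_mkord xpredT) (big_cat_nat (leq0n n) le_nm) /=.
by rewrite [X in _ + X]big_nat_cond [X in _ + X]big1 ?addr0 // => i /andP[/F0].
Qed.

Section Summable.
Variable V : zmodType.
Implicit Types F G : series (series V).

Definition vanish_below m (f : series V) := forall n, (n < m)%N -> f n = 0.
Definition summable F := forall m, vanish_below m (F m).

(** The sum of a family whose m-th term starts in degree m: in degree n it is a
    finite sum, as in [hexp]. *)
Definition series_total F : series V := fun n => \sum_(m < n.+1) F m n.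

Lemma series_totalE F N n : summable F -> (n < N)%N ->
  series_total F n = \sum_(m < N) F m n.
Proof.
move=> F0 ltnN; symmetry; apply: (sum_ord_tail0 (F := fun m => F m n)) => //.
by move=> i /andP[/F0].
Qed.
End Summable.

Section SummableRing.
Variable R : pzRingType.
Implicit Types (f h : series R) (F G : series (series R)).

Lemma vanish_belowM m p f h :
  vanish_below m f -> vanish_below p h -> vanish_below (m + p) (f * h).
Proof.
move=> f0 h0 n ltn; rewrite seriesM big1 // => i _.
have [/f0->|lemi] := ltnP i m; first by rewrite mul0r.
rewrite h0 ?mulr0 // ltn_subLR ?leq_ord //.
by apply: leq_trans ltn _; rewrite leq_add2r.
Qed.

(** A family is a series with coefficients in [series R]; in these terms
    [series_total] is the evaluation of that series at 1. *)
Lemma series_totalM F G : summable F -> summable G ->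
  series_total (F * G) = series_total F * series_total G.
Proof.
move=> F0 G0; apply/funext => n.
transitivity (\sum_(j < n.+1) \sum_(l < n.+1) (F j * G l) n).
  rewrite /series_total; under eq_bigr => m _ do rewrite seriesM series_sum.
  transitivity (\sum_(m < n.+1) \sum_(j < n.+1 | (j <= m)%N) (F j * G (m - j)%N) n).
    apply: eq_bigr => m _.
    rewrite (big_ord_widen n.+1 (fun j => (F j * G (m - j)%N) n)) //.
  rewrite (exchange_big_dep xpredT) //=; apply: eq_bigr => j _.
  rewrite -(big_geq_mkord _ n.+1 xpredT (fun m => (F j * G (m - j)%N) n)).
  rewrite -{1}[val j]add0n big_addn big_mkord.
  symmetry; under [RHS]eq_bigr => l _ do rewrite addnK.
  apply: (sum_ord_tail0 (F := fun l => (F j * G l) n)); first exact: leq_subr.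
  move=> l; rewrite leq_subLR => /andP[ltn _].
  by apply: (vanish_belowM (F0 j) (G0 l)).
rewrite seriesM.
transitivity (\sum_(i < n.+1) \sum_(j < n.+1) \sum_(l < n.+1)
    F j i * G l (n - i)%N); last first.
  apply: eq_bigr => i _; rewrite (series_totalE F0 (ltn_ord i)).
  by rewrite (@series_totalE _ G n.+1) ?ltnS ?leq_subr // big_distrlr.
rewrite [RHS]exchange_big; apply: eq_bigr => j _ /=.
by rewrite exchange_big; apply: eq_bigr => l _ /=.
Qed.
End SummableRing.

(** * Exponentials in a completed algebra *)

Section SeriesAlgebra.
Variable k : fieldType.

Section Lmodule.
Variable V : lmodType k.
Definition series_scale (c : k) (f : series V) : series V := fun n => c *: f n.

Fact series_scaleA a b f :
  series_scale a (series_scale b f) = series_scale (a * b) f.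
Proof. by apply/funext => n; apply: scalerA. Qed.
Fact series_scale1 : left_id 1 series_scale.
Proof. by move=> f; apply/funext => n; apply: scale1r. Qed.
Fact series_scaleDr : right_distributive series_scale +%R.
Proof. by move=> a f h; apply/funext => n; apply: scalerDr. Qed.
Fact series_scaleDl f : {morph series_scale^~ f : a b / a + b}.
Proof. by move=> a b; apply/funext => n; apply: scalerDl. Qed.

HB.instance Definition _ := GRing.Zmodule_isLmodule.Build k (series V)
  series_scaleA series_scale1 series_scaleDr series_scaleDl.

Lemma seriesZ c (f : series V) n : (c *: f) n = c *: f n. Proof. by []. Qed.
End Lmodule.

Variable R : algType k.
Implicit Types f h x : series R.

Lemma seriesZMl c f h : (c *: f) * h = c *: (f * h).
Proof.
apply/funext => n; rewrite seriesZ !seriesM scaler_sumr.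
by apply: eq_bigr => i _; rewrite seriesZ scalerAl.
Qed.
Lemma seriesZMr c f h : f * (c *: h) = c *: (f * h).
Proof.
apply/funext => n; rewrite seriesZ !seriesM scaler_sumr.
by apply: eq_bigr => i _; rewrite seriesZ scalerAr.
Qed.

(** Derivations of [series R] that need not act componentwise: locality lets
    them commute with infinite sums, and includes the inner derivations. *)
Definition local_derivation (D : series R -> series R) :=
  [/\ linear D, forall f h, D (f * h) = D f * h + f * D h
    & forall f m, vanish_below m f -> vanish_below m (D f)].

Definition series_comm x f : series R := x * f - f * x.

Lemma local_derivation_comm x : local_derivation (series_comm x).
Proof.
split=> [c f h|f h|f m f0 n ltnm]; rewrite /series_comm.
- by rewrite mulrDr mulrDl seriesZMr seriesZMl scalerBr addrACA opprD.
- by rewrite mulrBl mulrBr !mulrA subrKA.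
- rewrite -[n]/(0 + n)%N -[m]/(0 + m)%N in ltnm *.
  rewrite seriesD seriesN (@vanish_belowM _ 0%N m x f _ _ _ ltnm) //.
  by rewrite (@vanish_belowM _ m 0%N f x) ?subrr ?addn0.
Qed.

Definition divided_power x : series (series R) := fun m => (m`!%:R)^-1 *: x ^+ m.
Definition series_exp x := series_total (divided_power x).

(** F(ad x) y with F(t) = (e^t - 1) / t. *)
Definition ad_quotient x y : series (series R) :=
  fun j => (j.+1`!%:R)^-1 *: iter j (series_comm x) y.
Definition dexp x y := series_total (ad_quotient x y).

Hypothesis k_char0 : [pchar k] =i pred0.

Lemma natr_neq0 n : n.+1%:R != 0 :> k.
Proof. by move/pcharf0P: k_char0 => ->. Qed.

Lemma mulrSn_eq0 (V : lmodType k) (v : V) n : v *+ n.+1 = 0 -> v = 0.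
Proof.
move=> v0; rewrite -[v]scale1r -(mulVf (natr_neq0 n)) -scalerA scaler_nat v0.
exact: scaler0.
Qed.

Lemma mulrSn_inj (V : lmodType k) n : injective (fun v : V => v *+ n.+1).
Proof.
move=> v w /= e; apply/eqP; rewrite -subr_eq0; apply/eqP/(@mulrSn_eq0 _ _ n).
by rewrite mulrnBl e subrr.
Qed.

Lemma fact_inv n : (n.+1%:R : k) * (n.+1`!%:R)^-1 = (n`!%:R)^-1.
Proof. by rewrite factS natrM invfM mulVKf ?natr_neq0. Qed.

Lemma divided_powerS x m :
  divided_power x m.+1 *+ m.+1 = x * divided_power x m.
Proof. by rewrite -scaler_nat scalerA fact_inv seriesZMr exprS. Qed.

Lemma ad_quotientS x y j :
  ad_quotient x y j.+1 *+ j.+2 = series_comm x (ad_quotient x y j).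
Proof.
rewrite -scaler_nat scalerA fact_inv iterS /ad_quotient /series_comm.
by rewrite seriesZMr seriesZMl scalerBr.
Qed.

Lemma ad_quotient0 x y : ad_quotient x y 0 = y.
Proof. by rewrite /ad_quotient invr1 scale1r. Qed.

Lemma divided_power0 x : divided_power x 0 = 1.
Proof. by rewrite /divided_power invr1 scale1r. Qed.

(** With p_m = x^m/m! and q_j = ad(x)^j(Dx)/(j+1)!, this is
    D p_(m+1) = \sum_j q_j p_(m-j); after multiplication by m + 1, the induction
    step moves x to the right of q_j at the cost of [x, q_j] = (j+2) q_(j+1). *)
Lemma derivation_divided_power D x m : local_derivation D ->
  D (divided_power x m.+1) = (ad_quotient x (D x) * divided_power x) m.
Proof.
case=> Dlin DM _.
have DZ := plain_linearZ Dlin.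
set q := ad_quotient x (D x); set p := divided_power x.
elim: m => [|m IH].
  rewrite seriesM0 /q ad_quotient0 /p divided_power0 mulr1.
  by rewrite /divided_power invr1 scale1r expr1.
apply: (@mulrSn_inj _ m.+1); rewrite /= -[LHS]scaler_nat -DZ scaler_nat.
rewrite divided_powerS DM IH -/p.
pose a j := q j * p (m.+1 - j)%N.
have -> : x * (q * p) m = \sum_(j < m.+1) (a j *+ (m.+1 - j) + a j.+1 *+ j.+2).
  rewrite seriesM big_distrr; apply: eq_bigr => -[j /= lej] _.
  rewrite ltnS in lej.
  rewrite /a subSS -mulrnAr -mulrnAl (subSn lej) divided_powerS ad_quotientS.
  by rewrite /series_comm mulrBl !mulrA addrC subrK.
rewrite big_split /= addrCA.
have -> : D x * p m.+1 + \sum_(j < m.+1) a j.+1 *+ j.+2 = \sum_(j < m.+2) a j *+ j.+1.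
  by rewrite [RHS]big_ord_recl /a /q ad_quotient0 subn0.
have -> : \sum_(j < m.+1) a j *+ (m.+1 - j) = \sum_(j < m.+2) a j *+ (m.+1 - j).
  by rewrite [RHS]big_ord_recr /= subnn mulr0n addr0.
rewrite -big_split seriesM -sumrMnl; apply: eq_bigr => -[j /= ltj] _.
by rewrite -mulrnDr addnS subnK.
Qed.

Lemma summable_divided_power x : x 0%N = 0 -> summable (divided_power x).
Proof.
move=> x0 m n ltnm; rewrite [LHS]seriesZ.
suff -> : (x ^+ m) n = 0 by rewrite scaler0.
elim: m n ltnm => // m IH n ltnm; rewrite exprS -add1n in ltnm *.
by apply: (vanish_belowM (m := 1)) ltnm => // -[|i] // _.
Qed.

Lemma summable_ad_quotient x y : x 0%N = 0 -> summable (ad_quotient x y).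
Proof.
move=> x0 m n ltnm; rewrite [LHS]seriesZ.
suff -> : iter m (series_comm x) y n = 0 by rewrite scaler0.
have x1 : vanish_below 1 x by move=> [|i].
elim: m n ltnm => // m IH n; rewrite iterS => ltnm; rewrite [LHS]seriesD seriesN.
rewrite (vanish_belowM x1 IH) // (vanish_belowM IH x1) ?subrr //.
by rewrite addn1.
Qed.

(** The sum over m of the formula for D(x^m/m!): the double sum of the q_j p_l
    factors by [series_totalM]. *)
Lemma derivation_exp D x : local_derivation D -> x 0%N = 0 ->
  D (series_exp x) = dexp x (D x) * series_exp x.
Proof.
move=> DP x0; have sp := summable_divided_power x0.
rewrite -series_totalM //; last exact: summable_ad_quotient.
apply/funext => n; have [Dlin _ Dloc] := DP.
have DD := plain_linearD Dlin; have DN := plain_linearN Dlin.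
(* Modulo degrees above n, the exponential is a finite sum. *)
have -> : D (series_exp x) n = D (\sum_(m < n.+2) divided_power x m) n.
  apply/eqP; rewrite -subr_eq0 -seriesN -seriesD -DN -DD; apply/eqP.
  apply: (Dloc _ n.+1) => // i lti; rewrite seriesD seriesN series_sum.
  by rewrite [series_exp x i](series_totalE sp (N := n.+2)) ?subrr // ltnW.
rewrite (plain_linear_sum Dlin) series_sum big_ord_recl.
have -> : D (divided_power x 0) = 0.
  rewrite divided_power0; case: DP => _ DM _.
  by apply: (addrI (D 1)); rewrite addr0 -[in RHS](mulr1 1) DM mulr1 mul1r.
by rewrite add0r; apply: eq_bigr => m _; rewrite derivation_divided_power.
Qed.

End SeriesAlgebra.

(** * Euler operator, inverses and recursion *)

(** The derivation t d/dt of R[[t]]. *)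
Definition euler (V : zmodType) (f : series V) : series V := fun n => f n *+ n.

Lemma eulerM (R : pzRingType) (f h : series R) :
  euler (f * h) = euler f * h + f * euler h.
Proof.
apply/funext => n; rewrite seriesD !seriesM -big_split /euler seriesM -sumrMnl.
apply: eq_bigr => -[i /= lti] _; rewrite mulrnAl mulrnAr -mulrnDr subnKC //.
Qed.

Lemma local_derivation_euler (k : fieldType) (R : algType k) :
  local_derivation (@euler R).
Proof.
split=> [c f h|f h|f m f0 n /f0 fn]; last by rewrite /euler fn mul0rn.
  apply/funext => n; rewrite seriesD seriesZ /euler seriesD seriesZ.
  by rewrite mulrnDl scalerMnr.
exact: eulerM.
Qed.

(** The equation t X' = a X with a(0) = 0 gives n X_n in terms of the lower
    coefficients of X. *)
Lemma euler_unique (R : pzRingType) (a X Y : series R) :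
    (forall n, injective (fun v : R => v *+ n.+1)) -> a 0%N = 0 ->
    euler X = a * X -> euler Y = a * Y -> X 0%N = Y 0%N -> X = Y.
Proof.
move=> inj a0 eX eY e0; apply/funext => n; elim/ltn_ind: n => -[//|n] IH.
apply: (inj n); rewrite -[LHS]/(euler X n.+1) -[RHS]/(euler Y n.+1) eX eY.
rewrite !seriesM_recl a0 !mul0r; congr (_ + _).
by apply: eq_bigr => i _; rewrite IH // subSS ltnS leq_subr.
Qed.

Definition series_map (V W : Type) (F : V -> W) (f : series V) : series W :=
  fun n => F (f n).

Lemma series_mapM (R S : pzRingType) (F : {rmorphism R -> S}) f h :
  series_map F (f * h) = series_map F f * series_map F h.
Proof.
apply/funext => n; rewrite /series_map !seriesM rmorph_sum.
by apply: eq_bigr => i _; rewrite rmorphM.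
Qed.

Lemma series_map1 (R S : pzRingType) (F : {rmorphism R -> S}) :
  series_map F 1 = 1.
Proof. by apply/funext => n; rewrite /series_map !series1E rmorph_nat. Qed.

Lemma euler_map (V W : zmodType) (F : {additive V -> W}) f :
  euler (series_map F f) = series_map F (euler f).
Proof. by apply/funext => n; rewrite /euler /series_map raddfMn. Qed.

(** Dependent choice for a sequence whose n-th term has to satisfy a condition on
    the terms of index at most n; [t0] fills the positions not yet chosen. *)
Lemma strong_recursion (T : Type) (t0 : T) (P : nat -> (nat -> T) -> Prop) :
    (forall n x y, (forall m, (m <= n)%N -> x m = y m) -> P n x -> P n y) ->
    (forall n x, (forall m, (m < n)%N -> P m x) ->
                 (forall m, (n <= m)%N -> x m = t0) ->
       exists t, P n (fun m => if m == n then t else x m)) ->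
  exists x, forall n, P n x.
Proof.
move=> Ploc Pstep.
pose good n x := (forall m, (m < n)%N -> P m x) /\
  (forall m, (n <= m)%N -> x m = t0).
pose upd n (x : nat -> T) t m := if m == n then t else x m.
have [next nextP] : {next : nat * (nat -> T) -> T &
    forall p, good p.1 p.2 -> P p.1 (upd p.1 p.2 (next p))}.
  apply: (@choice _ _ (fun p t => good p.1 p.2 -> P p.1 (upd p.1 p.2 t))) => -[n x].
  have [[lo hi]|nok] := pselect (good n x).
    by have [t Pt] := Pstep n x lo hi; exists t.
  by exists t0.
pose X := fix X n := if n is m.+1 then upd m (X m) (next (m, X m)) else fun=> t0.
have stable n m i : (i < n)%N -> (n <= m)%N -> X m i = X n i.
  move=> ltin; elim: m => [|m IH]; first by rewrite leqn0 => /eqP e; rewrite e in ltin.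
  rewrite leq_eqVlt ltnS => /predU1P[->//|le_nm]; rewrite -IH //= /upd.
  by rewrite ltn_eqF // (leq_trans ltin).
have goodX n : good n (X n).
  elim: n => [|n IH]; first by split.
  split=> m; last by move=> ltnm; rewrite /= /upd gtn_eqF //; apply: IH.2; exact: ltnW.
  rewrite ltnS leq_eqVlt => /predU1P[->|ltmn]; first exact: (nextP (n, X n) IH).
  apply: Ploc (IH.1 _ ltmn) => i leim.
  by rewrite (stable n n.+1) // (leq_ltn_trans leim).
exists (fun n => X n.+1 n) => n; apply: Ploc ((goodX n.+1).1 n _) => // m lemn.
by rewrite (stable m.+1).
Qed.

(** The coefficients of the inverse are found recursively from a b = 1, inside
    the grading [K]; a right inverse whose constant term is 1 has itself a right
    inverse, hence is two-sided. *)
Lemma series_inverse (R : pzRingType) (K : nat -> R -> Prop) (a : series R) :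
    K 0%N 1 -> (forall n, K n 0) ->
    (forall n u v, K n u -> K n v -> K n (u - v)) ->
    (forall n m u v, K n u -> K m v -> K (n + m)%N (u * v)) ->
    (forall n, K n (a n)) -> a 0%N = 1 ->
  exists b : series R, [/\ forall n, K n (b n), b 0%N = 1, a * b = 1 & b * a = 1].
Proof.
move=> K1 K0 KB KM Ka a0.
have KD n u v : K n u -> K n v -> K n (u + v).
  by move=> Ku Kv; rewrite -[v]opprK; apply: (KB) => //; rewrite -sub0r; apply: (KB).
have K1n n : K n ((1 : series R) n) by case: n.
have rinv (c : series R) : (forall n, K n (c n)) -> c 0%N = 1 ->
    exists b : series R, [/\ forall n, K n (b n), b 0%N = 1 & c * b = 1].
  move=> Kc c0.
  have [||b bP] := @strong_recursion R 0
      (fun n b => K n (b n) /\ (c * b) n = (1 : series R) n).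
  - move=> n x y exy [Kx <-]; split; first by rewrite -exy.
    by rewrite !seriesM; apply: eq_bigr => i _; rewrite exy // leq_subr.
  - move=> n x lo _; pose r := \sum_(i < n) c i.+1 * x (n - i.+1)%N.
    exists ((1 : series R) n - r); rewrite eqxx; split.
      apply: KB => //; apply: big_ind => [|u v|[i /= lti] _]; [exact: K0|exact: KD|].
      rewrite -{1}(subnKC lti); apply: KM => //; apply: (lo _ _).1.
      by rewrite ltn_subrL (leq_trans _ lti).
    rewrite seriesM_recl eqxx c0 mul1r.
    rewrite [X in _ + X](_ : _ = r) ?subrK //; apply: eq_bigr => -[i /= lti] _.
    by rewrite ltn_eqF // ltn_subrL (leq_trans _ lti).
  have cb : c * b = 1 by apply/funext => n; have [] := bP n.
  exists b; split=> // [n|]; first by have [] := bP n.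
  by have := congr1 (fun f : series R => f 0%N) cb; rewrite /= seriesM0 c0 mul1r.
have [b [Kb b0 ab]] := rinv a Ka a0; have [c [_ _ bc]] := rinv b Kb b0.
exists b; split=> //; suff -> : a = c by [].
by rewrite -[a]mulr1 -bc mulrA ab mul1r.
Qed.

(** * Bilinearity of the Lie bracket *)

Section LieLinearity.
Variables (k : fieldType) (g : lieAlgType k).
Implicit Types x y : g.

Lemma lie0l y : lie 0 y = 0.
Proof. exact: plain_linear0 (lie_linearl y). Qed.
Lemma lie0r x : lie x 0 = 0.
Proof. exact: plain_linear0 (lie_linearr x). Qed.
Lemma lieZl c x y : lie (c *: x) y = c *: lie x y.
Proof. exact: plain_linearZ (lie_linearl y) _ _. Qed.
Lemma lieZr c x y : lie x (c *: y) = c *: lie x y.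
Proof. exact: plain_linearZ (lie_linearr x) _ _. Qed.
Lemma lieNr x y : lie x (- y) = - lie x y.
Proof. exact: plain_linearN (lie_linearr x) _. Qed.

Lemma lie_lie x y z : lie (lie x y) z = lie x (lie y z) - lie y (lie x z).
Proof.
rewrite (lieC (lie x y) z) (lieC x z) lieNr opprK; apply/eqP.
by rewrite eq_sym -subr_eq0 opprK lie_jacobi.
Qed.
End LieLinearity.

(** * Graded enveloping algebras *)

(** The completed enveloping algebra is used only through the following data:
    the gradings of L and U, the inclusion of L in U, the coproduct and the
    counit of U, and an operator T from U to L such that the coproduct
    \sum u_1 (x) u_2 of an element u of degree n satisfies
    n u = \sum T(u_1) u_2. *)
Record graded_envelope (k : fieldType) := GradedEnvelope {
  envelope_lie : lieAlgType k;
  envelope_alg : algType k;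
  lie_gr : nat -> envelope_lie -> Prop;
  alg_gr : nat -> envelope_alg -> Prop;
  incl : envelope_lie -> envelope_alg;
  cop : {rmorphism envelope_alg -> tensor envelope_alg envelope_alg};
  eps : envelope_alg -> k;
  log_der : envelope_alg -> envelope_lie;
  lie_gr0 : forall n, lie_gr n 0;
  lie_grP : forall n c x y, lie_gr n x -> lie_gr n y -> lie_gr n (c *: x + y);
  lie_gr_eq0 : forall x, lie_gr 0 x -> x = 0;
  lie_gr_lie : forall n m x y,
    lie_gr n x -> lie_gr m y -> lie_gr (n + m) (lie x y);
  alg_gr0 : forall n, alg_gr n 0;
  alg_grP : forall n c u v, alg_gr n u -> alg_gr n v -> alg_gr n (c *: u + v);
  alg_gr1 : alg_gr 0 1;
  alg_grM : forall n m u v, alg_gr n u -> alg_gr m v -> alg_gr (n + m) (u * v);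
  alg_gr_incl : forall n x, lie_gr n x -> alg_gr n (incl x);
  incl_linear : linear incl;
  incl_lie : forall x y, incl (lie x y) = incl x * incl y - incl y * incl x;
  incl_eq0 : forall n x, lie_gr n x -> incl x = 0 -> x = 0;
  cop_incl : forall x, cop (incl x) = tens 1 (incl x) + tens (incl x) 1;
  alg_gr0_eps : forall u, alg_gr 0 u -> u = eps u *: 1;
  eps_gr : forall n u, alg_gr n u -> (0 < n)%N -> eps u = 0;
  cop_eps : forall u n (a b : nat -> envelope_alg),
    cop u = \sum_(i < n) tens (a i) (b i) -> u = \sum_(i < n) eps (a i) *: b i;
  log_der_gr : forall n u, alg_gr n u -> lie_gr n (log_der u);
  cop_log_der : forall m u n (a b : nat -> envelope_alg), alg_gr m u ->
    cop u = \sum_(i < n) tens (a i) (b i) ->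
    u *+ m = \sum_(i < n) incl (log_der (a i)) * b i
}.

(** * Group-like series *)

Section TensorEmbeddings.
Variables (k : fieldType) (B : algType k).

Definition tensl (b : B) : tensor B B := tens b 1.
Definition tensr (b : B) : tensor B B := tens 1 b.

Fact tensl_linear : linear tensl.
Proof. by move=> c x y; rewrite /tensl tensDl tensZl. Qed.
Fact tensr_linear : linear tensr.
Proof. by move=> c x y; rewrite /tensr tensDr tensZr. Qed.
HB.instance Definition _ := GRing.isLinear.Build k B _ _ tensl tensl_linear.
HB.instance Definition _ := GRing.isLinear.Build k B _ _ tensr tensr_linear.
Fact tensl_monoid : monoid_morphism tensl.
Proof. by split=> [|x y]; rewrite /tensl ?tens11 // tensM mulr1. Qed.
Fact tensr_monoid : monoid_morphism tensr.
Proof. by split=> [|x y]; rewrite /tensr ?tens11 // tensM mulr1. Qed.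
HB.instance Definition _ := GRing.isMonoidMorphism.Build B _ tensl tensl_monoid.
HB.instance Definition _ := GRing.isMonoidMorphism.Build B _ tensr tensr_monoid.

Lemma tensl_tensrE (f h : series B) n :
  (series_map tensl f * series_map tensr h) n =
  \sum_(i < n.+1) tens (f i) (h (n - i)%N).
Proof. by rewrite seriesM; apply: eq_bigr => i _; rewrite tensM mulr1 mul1r. Qed.

Lemma tensl_tensr_comm (f h : series B) :
  series_map tensr h * series_map tensl f =
  series_map tensl f * series_map tensr h.
Proof.
apply/funext => n; rewrite tensl_tensrE [LHS]series_mul_rev.
by apply: eq_bigr => i _; rewrite tensM mulr1 mul1r.
Qed.
End TensorEmbeddings.

Section GroupLike.
Variables (k : fieldType) (G : graded_envelope k).
Hypothesis k_char0 : [pchar k] =i pred0.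
Local Notation L := (envelope_lie G).
Local Notation U := (envelope_alg G).
Local Notation jl := (series_map (@tensl k U)).
Local Notation jr := (series_map (@tensr k U)).
Local Notation Delta := (series_map (@cop k G)).
Local Notation sincl := (series_map (@incl k G)).
Implicit Types phi psi : series U.

Definition lie_graded (x : series L) : Prop := forall n, lie_gr n (x n).
Definition alg_graded (phi : series U) : Prop := forall n, alg_gr n (phi n).
Definition group_like (phi : series U) : Prop :=
  [/\ alg_graded phi, exists n, phi n != 0
    & forall n, cop G (phi n) = \sum_(i < n.+1) tens (phi i) (phi (n - i)%N)].

Lemma alg_gr_sum n I (r : seq I) (F : I -> U) :
  (forall i, alg_gr n (F i)) -> alg_gr n (\sum_(i <- r) F i).
Proof.
move=> KF; apply: big_ind => // [|u v]; first exact: alg_gr0.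
by move=> hu hv; rewrite -[u]scale1r; apply: alg_grP.
Qed.
Lemma alg_grB n (u v : U) : alg_gr n u -> alg_gr n v -> alg_gr n (u - v).
Proof. by move=> hu hv; rewrite addrC -scaleN1r; apply: alg_grP. Qed.

Lemma alg_graded_mul phi psi :
  alg_graded phi -> alg_graded psi -> alg_graded (phi * psi).
Proof.
move=> hphi hpsi n; rewrite seriesM; apply: alg_gr_sum => i.
by rewrite -{1}(subnKC (n := n) (m := i)) ?leq_ord //; apply: alg_grM.
Qed.

Lemma group_like_coproduct phi : group_like phi ->
  Delta phi = jl phi * jr phi.
Proof.
by case=> _ _ e; apply/funext => n; rewrite tensl_tensrE; apply: e.
Qed.

(** The counit turns the coproduct of phi into phi = c phi, with c the constant
    term of phi; as phi is nonzero, c = 1. *)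
Lemma group_like0 phi : group_like phi -> phi 0%N = 1.
Proof.
case=> Uphi [n phin] glphi; rewrite (alg_gr0_eps (Uphi 0%N)).
suff -> : eps (phi 0%N) = 1 by rewrite scale1r.
apply/eqP; rewrite -subr_eq0; apply: contraNT phin => c1.
have := cop_eps (a := phi) (b := fun i => phi (n - i)%N) (glphi n).
rewrite big_ord_recl subn0 big1 ?addr0.
  move=> e; have : (eps (phi 0%N) - 1) *: phi n = 0.
    by rewrite scalerBl scale1r -e subrr.
  by move/eqP; rewrite scaler_eq0 (negPf c1).
by move=> i _; rewrite (eps_gr (Uphi _)) // scale0r.
Qed.

Lemma group_likeP phi : alg_graded phi -> phi 0%N = 1 ->
  Delta phi = jl phi * jr phi -> group_like phi.
Proof.
move=> Uphi phi0 e; split=> //; first by exists 0%N; rewrite phi0 oner_neq0.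
by move=> n; rewrite -tensl_tensrE -e.
Qed.

Lemma group_like_mul phi psi : group_like phi -> group_like psi ->
  group_like (phi * psi).
Proof.
move=> glphi glpsi; apply: group_likeP.
- by apply: alg_graded_mul; [case: glphi|case: glpsi].
- by rewrite seriesM0 !group_like0 // mulr1.
rewrite !series_mapM !group_like_coproduct // !mulrA; congr (_ * _).
by rewrite -!mulrA tensl_tensr_comm.
Qed.

Lemma group_like_inverse phi : group_like phi ->
  exists psi, [/\ group_like psi, phi * psi = 1 & psi * phi = 1].
Proof.
move=> glphi; have [Uphi _ _] := glphi.
have [|||psi [Upsi psi0 phipsi psiphi]] := @series_inverse U (@alg_gr k G) phi
  (alg_gr1 G) _ _ _ Uphi (group_like0 glphi).
- by move=> n; apply: alg_gr0.
- by move=> n u v; apply: alg_grB.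
- by move=> n m u v; apply: alg_grM.
exists psi; split=> //; apply: group_likeP => //.
(* Both sides are inverse to the coproduct of phi. *)
have inv : Delta phi * (jl psi * jr psi) = 1.
  rewrite group_like_coproduct // -tensl_tensr_comm -mulrA [jl phi * _]mulrA.
  by rewrite -series_mapM phipsi series_map1 mul1r -series_mapM phipsi series_map1.
rewrite -[LHS]mulr1 -inv mulrA -series_mapM psiphi series_map1.
by rewrite mul1r.
Qed.

(** In degree n, group-likeness turns the formula for n phi_n into
    n phi_n = \sum_i T(phi_i) phi_(n-i). *)
Lemma group_like_log_derivative phi : group_like phi ->
  exists theta, lie_graded theta /\ euler phi = sincl theta * phi.
Proof.
case=> Uphi _ glphi; exists (series_map (@log_der k G) phi).
split=> [n|]; first exact: log_der_gr.
by apply/funext => n; apply: (@cop_log_der _ _ _ _ _ phi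
  (fun i => phi (n - i)%N) (Uphi n) (glphi n)).
Qed.

Lemma sincl0 theta : lie_graded theta -> sincl theta 0%N = 0.
Proof.
move=> /(_ 0%N)/lie_gr_eq0 e; rewrite /series_map e.
exact: plain_linear0 (@incl_linear k G).
Qed.

(** Delta phi and phi (x) phi agree in degree 0 and both solve
    t X' = (theta (x) 1 + 1 (x) theta) X. *)
Lemma log_derivative_group_like theta phi : lie_graded theta -> alg_graded phi ->
  phi 0%N = 1 -> euler phi = sincl theta * phi -> group_like phi.
Proof.
move=> Ltheta Uphi phi0 ephi; apply: group_likeP => //.
apply: (euler_unique (a := Delta (sincl theta))).
- by move=> n; apply: mulrSn_inj.
- by rewrite -[LHS]/(cop G (sincl theta 0%N)) sincl0 // rmorph0.
- by rewrite euler_map ephi series_mapM.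
- rewrite eulerM !euler_map ephi !series_mapM.
  have -> : Delta (sincl theta) = jr (sincl theta) + jl (sincl theta).
    by apply/funext => n; apply: cop_incl.
  rewrite mulrDl [RHS]addrC -!mulrA; congr (_ + _).
  by rewrite !mulrA tensl_tensr_comm.
- by rewrite seriesM0 /series_map phi0 !rmorph1 mulr1.
Qed.

(** * Exponentials of Lie series *)

Implicit Types x y : series L.

Definition lie_series x y : series L :=
  fun n => \sum_(i < n.+1) lie (x i) (y (n - i)%N).

(** The Lie series F(ad x) y with F(t) = (e^t - 1) / t. *)
Definition lie_dexp x y : series L :=
  series_total (fun j => (j.+1`!%:R)^-1 *: iter j (lie_series x) y : series L).

Lemma sinclD x y : sincl (x + y) = sincl x + sincl y.
Proof. by apply/funext => n; apply: plain_linearD (@incl_linear k G) _ _. Qed.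
Lemma sinclN x : sincl (- x) = - sincl x.
Proof. by apply/funext => n; apply: plain_linearN (@incl_linear k G) _. Qed.

Lemma sincl_lie_series x y : sincl (lie_series x y) = series_comm (sincl x) (sincl y).
Proof.
apply/funext => n; rewrite /series_map (plain_linear_sum (@incl_linear k G)).
under eq_bigr => i _ do rewrite incl_lie.
by rewrite [RHS]seriesD seriesN [X in _ - X]series_mul_rev -sumrB.
Qed.

Lemma sincl_lie_dexp x y : sincl (lie_dexp x y) = dexp (sincl x) (sincl y).
Proof.
apply/funext => n; rewrite /series_map (plain_linear_sum (@incl_linear k G)).
apply: eq_bigr => j _; rewrite seriesZ (plain_linearZ (@incl_linear k G)).
rewrite [RHS]seriesZ; congr (_ *: _).
suff -> : iter j (series_comm (sincl x)) (sincl y) = sincl (iter j (lie_series x) y).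
  by [].
by elim: {j}(val j) => //= j ->; rewrite sincl_lie_series.
Qed.

(** The two instances are L itself, to find v, and the kernel of d, to place a
    logarithm in it. *)
Definition graded_subalgebra (K : nat -> L -> Prop) : Prop :=
  [/\ forall n a, K n a -> lie_gr n a, forall n, K n 0,
      forall n c a b, K n a -> K n b -> K n (c *: a + b)
    & forall n m a b, K n a -> K m b -> K (n + m)%N (lie a b)].

Section Subalgebra.
Variable K : nat -> L -> Prop.
Hypothesis KP : graded_subalgebra K.
Implicit Types a b : L.

Lemma subalgebra_eq0 a : K 0%N a -> a = 0.
Proof. by case: KP => Kgr _ _ _ /Kgr/lie_gr_eq0. Qed.
Lemma subalgebra_scale n c a : K n a -> K n (c *: a).
Proof. by case: KP => _ K0 KD _ Ka; rewrite -[_ *: _]addr0; apply: KD. Qed.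
Lemma subalgebraD n a b : K n a -> K n b -> K n (a + b).
Proof. by case: KP => _ _ KD _ Ka Kb; rewrite -[a]scale1r; apply: KD. Qed.
Lemma subalgebraB n a b : K n a -> K n b -> K n (a - b).
Proof.
by move=> Ka Kb; rewrite -scaleN1r; apply: subalgebraD => //; apply: subalgebra_scale.
Qed.
Lemma subalgebra_sum n I (r : seq I) (F : I -> L) :
  (forall i, K n (F i)) -> K n (\sum_(i <- r) F i).
Proof.
by case: KP => _ K0 _ _ KF; apply: big_ind => // a b; apply: subalgebraD.
Qed.

Lemma lie_series_closed x y :
    (forall n, K n (x n)) -> (forall n, K n (y n)) ->
  forall n, K n (lie_series x y n).
Proof.
case: (KP) => _ _ _ Klie Kx Ky n; apply: subalgebra_sum => i.
by rewrite -{1}(subnKC (n := n) (m := i)) ?leq_ord //; apply: Klie.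
Qed.

Lemma lie_dexp_closed x y :
    (forall n, K n (x n)) -> (forall n, K n (y n)) ->
  forall n, K n (lie_dexp x y n).
Proof.
move=> Kx Ky n; apply: subalgebra_sum => j; apply: subalgebra_scale.
by move: {j}(val j) => j; elim: j n => //= j IH; apply: lie_series_closed.
Qed.
End Subalgebra.

Lemma lie_series_local n x x' y y' : x 0%N = 0 -> x' 0%N = 0 ->
    y 0%N = 0 -> y' 0%N = 0 ->
    (forall m, (m < n)%N -> x m = x' m) -> (forall m, (m < n)%N -> y m = y' m) ->
  lie_series x y n = lie_series x' y' n.
Proof.
move=> x0 x0' y0 y0' ex ey; apply: eq_bigr => -[[|i] /= lti] _.
  by rewrite x0 x0' !lie0l.
rewrite ltnS in lti; have := lti; rewrite leq_eqVlt => /predU1P[e|ltin].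
  by rewrite e subnn y0 y0' !lie0r.
by rewrite ex // ey // ltn_subrL (leq_trans _ lti).
Qed.

Lemma iter_lie_series0 x y j : x 0%N = 0 -> y 0%N = 0 ->
  iter j (lie_series x) y 0%N = 0.
Proof.
move=> x0 y0; case: j => [//|j]; rewrite iterS /lie_series big_ord_recl big_ord0.
by rewrite x0 lie0l addr0.
Qed.

(** In degree n, F(ad x) y is y_n plus brackets of terms of lower degree. *)
Lemma lie_dexp_local n x x' y y' : x 0%N = 0 -> x' 0%N = 0 ->
    y 0%N = 0 -> y' 0%N = 0 ->
    (forall m, (m < n)%N -> x m = x' m) -> (forall m, (m < n)%N -> y m = y' m) ->
  lie_dexp x y n - y n = lie_dexp x' y' n - y' n.
Proof.
move=> x0 x0' y0 y0' ex ey; rewrite /lie_dexp /series_total !big_ord_recl.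
rewrite !seriesZ !invr1 !scale1r ![_ + _ - _]addrAC !subrr !add0r.
apply: eq_bigr => j _; rewrite !seriesZ; congr (_ *: _).
rewrite !lift0 !iterS.
apply: lie_series_local => //; try exact: iter_lie_series0.
move: {j}(val j) => j; elim: j => [//|j IH] m ltmn; rewrite !iterS.
apply: lie_series_local => //; try exact: iter_lie_series0.
- by move=> i ltim; apply: ex; apply: ltn_trans ltmn.
- by move=> i ltim; apply: IH; apply: ltn_trans ltmn.
Qed.

(** Solving F(ad x) (h x) = prescribed data degree by degree: when the degree n
    part of h x involves x_n only through [l n (x n)], so does that of
    F(ad x) (h x). *)
Lemma lie_dexp_solve (K : nat -> L -> Prop) (h : series L -> series L)
    (l : nat -> L -> L) (Q : nat -> L -> Prop) :
    graded_subalgebra K ->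
    (forall x, (forall n, K n (x n)) -> forall n, K n (h x n)) ->
    (forall n x x', (forall m, K m (x m)) -> (forall m, K m (x' m)) ->
       (forall m, (m < n)%N -> x m = x' m) ->
       h x n - l n (x n) = h x' n - l n (x' n)) ->
    (forall n, l n 0 = 0) ->
    (forall n a, K n a -> exists b, K n b /\ Q n (a + l n b)) ->
  exists x, (forall n, K n (x n)) /\ forall n, Q n (lie_dexp x (h x) n).
Proof.
move=> KP Kh hloc l0 Qsolve; have [_ K0 _ _] := KP.
(* Truncations keep all series in K, where the hypotheses on h apply. *)
pose tr n (x : nat -> L) : series L := fun m => if (m <= n)%N then x m else 0.
pose P n (x : nat -> L) := K n (x n) /\ Q n (lie_dexp (tr n x) (h (tr n x)) n).
have Kz (z : series L) : (forall m, K m (z m)) -> z 0%N = 0.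
  by move=> hz; apply: (subalgebra_eq0 KP).
have loc n x x' : (forall m, K m (x m)) -> (forall m, K m (x' m)) ->
    (forall m, (m < n)%N -> x m = x' m) ->
    lie_dexp x (h x) n - l n (x n) = lie_dexp x' (h x') n - l n (x' n).
  move=> Kx Kx' exx'.
  have hh m : (m < n)%N -> h x m = h x' m.
    move=> ltmn; rewrite -[h x m](subrK (l m (x m))) (hloc m x x') //.
      by rewrite exx' // subrK.
    by move=> i ltim; apply: exx'; apply: ltn_trans ltmn.
  have := @lie_dexp_local n x x' (h x) (h x') (Kz _ Kx) (Kz _ Kx')
    (Kz _ (Kh _ Kx)) (Kz _ (Kh _ Kx')) exx' hh.
  move/(congr1 (fun z => z + (h x n - l n (x n)))).
  by rewrite addrA subrK (hloc n x x') // addrA subrK.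
have [|n x lo hi|x xP] := @strong_recursion L 0 P.
- move=> n x x' exx' [Kx Qx].
  have e : tr n x = tr n x'.
    by apply/funext => m; rewrite /tr; case: leqP => // /exx'.
  by rewrite /P -e -exx'.
- have Kx m : K m (x m).
    by have [/lo[]//|/hi->] := ltnP m n.
  have [b [Kb Qb]] := Qsolve n _ (lie_dexp_closed KP Kx (Kh x Kx) n).
  exists b; rewrite /P eqxx; split=> //.
  set z := tr n _.
  have Kz' m : K m (z m).
    by rewrite /z /tr; case: leqP => // _; case: eqP => [->|_].
  have := @loc n z x Kz' Kx; rewrite (hi n) // l0 subr0.
  have -> : z n = b by rewrite /z /tr leqnn eqxx.
  move=> e; rewrite -[lie_dexp z _ n](subrK (l n b)) e // => m ltmn.
  by rewrite /z /tr (ltnW ltmn) ltn_eqF.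
have Kx n : K n (x n) by have [] := xP n.
exists x; split=> // n; have [_] := xP n.
have Kt m : K m (tr n x m) by rewrite /tr; case: leqP.
have := @loc n (tr n x) x Kt Kx; have -> : tr n x n = x n by rewrite /tr leqnn.
move=> e; rewrite -[X in Q n X -> _](subrK (l n (x n))) e.
  by rewrite subrK.
by move=> m ltmn; rewrite /tr (ltnW ltmn).
Qed.

Lemma graded_subalgebra_lie_gr : graded_subalgebra (@lie_gr k G).
Proof.
by split=> //; [exact: lie_gr0|exact: lie_grP|exact: lie_gr_lie].
Qed.

Lemma series_exp0 (X : series U) : series_exp X 0%N = 1.
Proof.
by rewrite /series_exp /series_total big_ord_recl big_ord0 addr0 divided_power0.
Qed.

Lemma alg_graded_exp x : lie_graded x -> alg_graded (series_exp (sincl x)).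
Proof.
move=> Lx n; apply: alg_gr_sum => m.
rewrite [divided_power _ _ _]seriesZ -[_ *: _]addr0.
apply: alg_grP; last exact: alg_gr0.
move: {m}(val m) => m; elim: m n => [|m IH] n.
  by rewrite expr0 series1E; case: n => [|n]; [exact: alg_gr1|exact: alg_gr0].
by rewrite exprS; apply: alg_graded_mul => // i; apply: alg_gr_incl.
Qed.

Lemma euler_exp x : lie_graded x ->
  euler (series_exp (sincl x)) =
  sincl (lie_dexp x (euler x)) * series_exp (sincl x).
Proof.
move=> Lx; rewrite (derivation_exp k_char0 (local_derivation_euler U)) ?sincl0 //.
rewrite sincl_lie_dexp; congr (dexp _ _ * _); apply/funext => n.
by rewrite /euler /series_map -!scaler_nat (plain_linearZ (@incl_linear k G)).
Qed.

Lemma group_like_exp x : lie_graded x -> group_like (series_exp (sincl x)).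
Proof.
move=> Lx; apply: (log_derivative_group_like _ _ _ (euler_exp Lx)).
- apply: (lie_dexp_closed graded_subalgebra_lie_gr Lx) => n.
  by rewrite /euler -scaler_nat; apply: (subalgebra_scale graded_subalgebra_lie_gr).
- exact: alg_graded_exp.
- exact: series_exp0.
Qed.

(** A solution of t phi' = theta phi is the exponential of the Lie series x with
    F(ad x) (t x') = theta, which can be solved for x inside any graded
    subalgebra containing theta since n is invertible. *)
Lemma log_derivative_exp (K : nat -> L -> Prop) phi theta :
    graded_subalgebra K -> (forall n, K n (theta n)) -> phi 0%N = 1 ->
    euler phi = sincl theta * phi ->
  exists x, (forall n, K n (x n)) /\ phi = series_exp (sincl x).
Proof.
move=> KP Ktheta phi0 ephi; have [Kgr K0 _ _] := KP.
have [||||x [Kx xP]] := @lie_dexp_solve K (@euler L) (fun n a => a *+ n)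
  (fun n a => a = theta n) KP.
- by move=> x Kx n; rewrite /euler -scaler_nat; apply: (subalgebra_scale KP).
- by move=> n x x' _ _ _; rewrite /euler !subrr.
- by move=> n; rewrite mul0rn.
- move=> [|n] a Ka.
    exists 0; rewrite mul0rn addr0 (subalgebra_eq0 KP Ka).
    by rewrite (subalgebra_eq0 KP (Ktheta 0%N)).
  exists (n.+1%:R^-1 *: (theta n.+1 - a)); split.
    by apply: (subalgebra_scale KP); apply: (subalgebraB KP).
  by rewrite -scaler_nat scalerA divff ?natr_neq0 // scale1r addrC subrK.
have Lx : lie_graded x by move=> n; apply: Kgr.
exists x; split=> //; apply: (euler_unique (a := sincl theta)) => //.
- by move=> n; apply: mulrSn_inj.
- by apply: sincl0 => n; apply: Kgr.
- rewrite euler_exp //; congr (_ * _); congr (sincl _).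
  by apply/funext.
- by rewrite series_exp0.
Qed.

(** * Conjugation by group-like series *)

Section Conjugation.
Variables (d : L -> L) (D : U -> U).
Hypothesis d_linear : linear d.
Hypothesis d_lie : forall a b, d (lie a b) = lie (d a) b + lie a (d b).
Hypothesis d_gr : forall n a, lie_gr n a -> lie_gr n (d a).
Hypothesis D_linear : linear D.
Hypothesis DM : forall u v, D (u * v) = D u * v + u * D v.
Hypothesis D_incl : forall a, D (incl a) = incl (d a).
Hypothesis d_sum : forall n a, lie_gr n a ->
  exists b c, [/\ lie_gr n b, d b = 0, lie_gr n c & a = b + d c].
Hypothesis d_sq0 : forall n a, lie_gr n a -> d (d a) = 0 -> d a = 0.

Local Notation sD := (series_map D).

Definition lie_ker (x : series L) : Prop := lie_graded x /\ forall n, d (x n) = 0.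

Definition conj_series (x y : series L) : Prop :=
  exists phi, group_like phi /\ sD phi + sincl y * phi = phi * sincl x.

Lemma local_derivation_map : local_derivation sD.
Proof.
split=> [c f h|f h|f m f0 n /f0 fn].
- by apply/funext => n; apply: D_linear.
- apply/funext => n; rewrite seriesD /series_map !seriesM (plain_linear_sum D_linear).
  by rewrite -big_split; apply: eq_bigr => i _; apply: DM.
- by rewrite /series_map fn (plain_linear0 D_linear).
Qed.

Lemma sDM phi psi : sD (phi * psi) = sD phi * psi + phi * sD psi.
Proof. by case: local_derivation_map. Qed.

Lemma sD1 : sD (1 : series U) = 0.
Proof.
apply: (addrI (sD 1)); rewrite addr0 -[in RHS](mulr1 (1 : series U)) sDM.
by rewrite mulr1 mul1r.
Qed.

Lemma conj_series_sym x y : conj_series x y -> conj_series y x.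
Proof.
case=> phi [glphi e]; have [psi [glpsi phipsi psiphi]] := group_like_inverse glphi.
exists psi; split=> //.
have Dpsi : psi * sD phi * psi = - sD psi.
  apply/eqP; rewrite -addr_eq0; apply/eqP.
  rewrite -mulrA -[X in _ + X]mul1r -psiphi -[psi * phi * _]mulrA -mulrDr.
  by rewrite -sDM phipsi sD1 mulr0.
have := congr1 (fun f => psi * f * psi) e; rewrite /= mulrDr mulrDl Dpsi.
rewrite -!mulrA phipsi mulr1 [psi * (phi * _)]mulrA psiphi mul1r => <-.
by rewrite addrA subrr add0r.
Qed.

Lemma conj_series_trans x y z :
  conj_series x y -> conj_series y z -> conj_series x z.
Proof.
move=> [phi [glphi e]] [psi [glpsi e']]; exists (psi * phi).
split; first exact: group_like_mul.
by rewrite sDM mulrA addrAC -mulrDl e' -!mulrA -mulrDr addrC e.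
Qed.

Lemma graded_subalgebra_ker :
  graded_subalgebra (fun n a => lie_gr n a /\ d a = 0).
Proof.
split=> [n a []//|n|n c a b [La da] [Lb db]|n m a b [La da] [Lb db]].
- by split; [exact: lie_gr0|exact: plain_linear0].
- split; first exact: lie_grP.
  by rewrite d_linear da db scaler0 addr0.
- split; first exact: lie_gr_lie.
  by rewrite d_lie da db lie0l lie0r addr0.
Qed.

(** Let theta be the logarithmic derivative of phi. If phi and theta are killed by
    d below degree n, then in degree n the conjugation equation gives
    d^2 phi_n = 0 and n phi_n = \sum theta_i phi_(n-i) gives n d phi_n = d theta_n.
    Hence d theta_n is in the kernel and in the image of d. *)
Lemma conj_ker phi theta x y : group_like phi ->
    lie_graded theta -> euler phi = sincl theta * phi -> lie_ker x -> lie_ker y ->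
    sD phi + sincl y * phi = phi * sincl x ->
  forall n, D (phi n) = 0 /\ d (theta n) = 0.
Proof.
move=> glphi Ltheta etheta [Lx dx] [Ly dy] e.
have D0 := plain_linear0 D_linear; have phi0 := group_like0 glphi.
have D1 : D 1 = 0 by have := congr1 (fun f : series U => f 0%N) sD1.
have D_ker (z : series L) n : d (z n) = 0 -> D (sincl z n) = 0.
  by move=> dz; rewrite /series_map D_incl dz (plain_linear0 (@incl_linear k G)).
elim/ltn_ind => -[_|n IH].
  rewrite phi0; split=> //.
  by rewrite (lie_gr_eq0 (Ltheta 0%N)) (plain_linear0 d_linear).
have DDphi : D (D (phi n.+1)) = 0.
  have := congr1 (fun f : series U => D (f n.+1)) e.
  rewrite seriesD (plain_linearD D_linear) seriesM_recl seriesM_recr !sincl0 //.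
  rewrite mul0r mulr0 add0r addr0 !(plain_linear_sum D_linear).
  rewrite [X in _ + X]big1 ?addr0 => [->|i _]; last first.
    by rewrite DM D_ker // mul0r add0r (IH _ _).1 ?mulr0 // subSS ltnS leq_subr.
  by apply: big1 => i _; rewrite DM D_ker // mulr0 addr0 (IH _ _).1 ?mul0r.
have nDphi : D (phi n.+1) *+ n.+1 = incl (d (theta n.+1)).
  have := congr1 (fun f : series U => D (f n.+1)) etheta.
  rewrite /euler -scaler_nat (plain_linearZ D_linear) scaler_nat => ->.
  rewrite seriesM_recr phi0 mulr1 (plain_linearD D_linear) (plain_linear_sum D_linear).
  rewrite big1 ?add0r => [|[[|i] /= lti] _]; first exact: D_incl.
    by rewrite sincl0 // mul0r.
  rewrite DM D_ker ?(IH _ _).2 // mul0r add0r (IH _ _).1 ?mulr0 //.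
  by rewrite subSS ltnS leq_subr.
have dtheta : d (theta n.+1) = 0.
  apply: (d_sq0 (Ltheta n.+1)); apply: (incl_eq0 (d_gr (d_gr (Ltheta n.+1)))).
  by rewrite -D_incl -nDphi -scaler_nat (plain_linearZ D_linear) DDphi scaler0.
split=> //; apply: (mulrSn_eq0 k_char0 (n := n)).
by rewrite nDphi dtheta (plain_linear0 (@incl_linear k G)).
Qed.

Lemma conj_ker_exp x y : lie_ker x -> lie_ker y -> conj_series x y ->
  exists z, lie_ker z /\
    sincl y * series_exp (sincl z) = series_exp (sincl z) * sincl x.
Proof.
move=> kx ky [phi [glphi e]].
have [theta [Ltheta etheta]] := group_like_log_derivative glphi.
have ker := conj_ker glphi Ltheta etheta kx ky e.
have [||z [Kz ez]] := log_derivative_exp graded_subalgebra_ker _ _ etheta.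
- by move=> n; split=> //; have [] := ker n.
- exact: group_like0.
exists z; split; first by split=> n; have [] := Kz n.
rewrite -ez -e; have -> : sD phi = 0 by apply/funext => n; have [] := ker n.
by rewrite add0r.
Qed.

Lemma exp_ker_conj x y z : lie_ker z ->
    sincl y * series_exp (sincl z) = series_exp (sincl z) * sincl x ->
  conj_series x y.
Proof.
move=> [Lz dz] e; exists (series_exp (sincl z)); split; first exact: group_like_exp.
rewrite (derivation_exp k_char0 local_derivation_map) ?sincl0 //.
have -> : sD (sincl z) = sincl 0.
  by apply/funext => n; rewrite /series_map D_incl dz.
have dexp0 : lie_dexp z 0 = 0.
  apply/funext => n; apply: big1 => j _; rewrite seriesZ.
  suff -> : iter j (lie_series z) 0 = 0 by rewrite scaler0.
  elim: {j}(val j) => //= j ->; apply/funext => m.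
  by apply: big1 => i _; rewrite lie0r.
rewrite -sincl_lie_dexp dexp0.
have -> : sincl 0 = 0 by apply/funext => n; apply: plain_linear0 (@incl_linear k G).
by rewrite mul0r add0r.
Qed.

(** For phi = exp x, the derivative formula applied to f |-> f u - u f - d f shows
    that phi conjugates u to v = u + F(ad x) ([x, u] - d x). Its degree n part is
    -d x_n up to u_n and lower components of x, so that x_n can be chosen to
    remove the part of v_n in the image of d. *)
Lemma conj_to_ker u : lie_graded u -> exists v, lie_ker v /\ conj_series u v.
Proof.
move=> Lu; pose h (x : series L) : series L := lie_series x u - series_map d x.
have LP := graded_subalgebra_lie_gr.
have [||||x [Lx xP]] := @lie_dexp_solve (@lie_gr k G) h (fun _ a => - d a)
  (fun n a => d (u n + a) = 0) LP.
- move=> x Lx n; apply: (subalgebraB LP); last exact: d_gr.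
  exact: (lie_series_closed LP).
- move=> n x x' Lx Lx' exx'; rewrite /h !seriesD !seriesN !opprK !subrK.
  by apply: lie_series_local => //; apply: lie_gr_eq0.
- by move=> n; rewrite (plain_linear0 d_linear) oppr0.
- move=> n a La; have [b [c [Lb db Lc e]]] := d_sum (subalgebraD LP (Lu n) La).
  by exists c; rewrite addrA e addrK.
have Lh n : lie_gr n (h x n).
  apply: (subalgebraB LP); last exact: d_gr.
  exact: (lie_series_closed LP).
exists (u + lie_dexp x (h x)); split.
  split=> n; last exact: xP.
  by apply: (subalgebraD LP) => //; apply: (lie_dexp_closed LP).
set phi := series_exp (sincl x).
exists phi; split; first exact: group_like_exp.
pose delta f := series_comm (- sincl u) f - sD f.
have deltaP : local_derivation delta.
  have [l1 m1 v1] := local_derivation_comm (- sincl u).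
  have [l2 m2 v2] := local_derivation_map.
  split=> [c f f'|f f'|f m f0 n ltnm]; rewrite /delta.
  - by rewrite l1 l2 opprD addrACA -scalerBr.
  - by rewrite m1 m2 opprD addrACA -mulrBl -mulrBr.
  - by rewrite seriesD seriesN (v1 f m) // (v2 f m) // subrr.
have := derivation_exp k_char0 deltaP (sincl0 Lx); rewrite -/phi.
have -> : delta (sincl x) = sincl (h x).
  rewrite /h sinclD sinclN sincl_lie_series /delta /series_comm.
  rewrite mulNr mulrN opprK addrC [in RHS]addrC; congr (_ + _); last by rewrite addrC.
  by congr (- _); apply/funext => n; apply: D_incl.
rewrite -sincl_lie_dexp sinclD mulrDl => <-.
rewrite /delta /series_comm mulNr mulrN opprK -addrA addNKr.
by rewrite addrCA subrr addr0.
Qed.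

Theorem conj_ker_theorem u : lie_graded u ->
  (exists v, lie_ker v /\ conj_series u v) /\
  (forall v, lie_ker v -> conj_series v u -> forall w, lie_ker w ->
     (conj_series w u <-> exists x, lie_ker x /\
        sincl v * series_exp (sincl x) = series_exp (sincl x) * sincl w)).
Proof.
move=> Lu; split; first exact: conj_to_ker.
move=> v kv vu w kw; split=> [wu|[x [kx e]]].
  exact: conj_ker_exp (conj_series_trans wu (conj_series_sym vu)).
exact: conj_series_trans (exp_ker_conj kx e) vu.
Qed.
End Conjugation.
End GroupLike.

(** * Cyclic modules over the enveloping algebra *)

Section Orbit.
Variables (k : fieldType) (g : lieAlgType k) (M : lmodType k).
Variables (act : g -> M -> M) (m0 : M).
Hypothesis act_linearl : forall m, linear (act^~ m).
Hypothesis act_linearr : forall x, linear (act x).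
Hypothesis act_lie : forall x y m,
  act (lie x y) m = act x (act y m) - act y (act x m).

(* The map w |-> w m0 on any algebra F spanned by the words in g. *)
Section FreeOrbit.
Variables (F : algType k) (gn : g -> F) (O : F -> M).
Hypothesis F_ind : forall P : F -> Prop,
  (forall u v, P u -> P v -> P (u + v)) ->
  (forall c s, P (c *: \prod_(x <- s) gn x)) -> forall v, P v.
Hypothesis O_linear : linear O.
Hypothesis O_word : forall s, O (\prod_(x <- s) gn x) = foldr act m0 s.

Lemma free_orbit_gen x v : O (gn x * v) = act x (O v).
Proof.
elim/F_ind: v => [u v hu hv|c s].
  by rewrite mulrDr !(plain_linearD O_linear) hu hv (plain_linearD (act_linearr x)).
rewrite -scalerAr !(plain_linearZ O_linear).
rewrite (plain_linearZ (act_linearr x)); congr (_ *: _).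
by rewrite O_word -[RHS]/(foldr act m0 (x :: s)) -O_word big_cons.
Qed.

Let OB a b : O (a - b) = O a - O b.
Proof. by rewrite (plain_linearD O_linear) (plain_linearN O_linear). Qed.

Lemma free_orbit_relD x y v : O ((gn (x + y) - gn x - gn y) * v) = 0.
Proof.
rewrite !mulrBl !OB !free_orbit_gen (plain_linearD (act_linearl (O v))).
by rewrite -addrA -opprD subrr.
Qed.
Lemma free_orbit_relZ c x v : O ((gn (c *: x) - c *: gn x) * v) = 0.
Proof.
rewrite mulrBl OB -scalerAl (plain_linearZ O_linear) !free_orbit_gen.
by rewrite (plain_linearZ (act_linearl (O v))) subrr.
Qed.
Lemma free_orbit_relL x y v :
  O ((gn x * gn y - gn y * gn x - gn (lie x y)) * v) = 0.
Proof. by rewrite !mulrBl !OB -!mulrA !free_orbit_gen act_lie subrr. Qed.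

Lemma free_orbit_ideal a s b : (forall v, O (s * v) = 0) -> O (a * s * b) = 0.
Proof.
move=> hs; rewrite -mulrA; elim/F_ind: a => [u v hu hv|c w].
  by rewrite mulrDl (plain_linearD O_linear) hu hv addr0.
rewrite -scalerAl (plain_linearZ O_linear).
suff -> : O (\prod_(x <- w) gn x * (s * b)) = 0 by rewrite scaler0.
elim: w => [|x w IH]; first by rewrite big_nil mul1r hs.
by rewrite big_cons -mulrA free_orbit_gen IH (plain_linear0 (act_linearr x)).
Qed.
End FreeOrbit.

Local Notation F := (freealg k g).
Local Notation pi := (proj (@env_ideal k g) : F -> env g).

(** The map u |-> u m0 for the representation of U that extends [act]. *)
Definition env_orbit (u : env g) : M :=
  freealg_lift (fun s => foldr act m0 s) (repr u).

Let O : F -> M := freealg_lift (fun s => foldr act m0 s).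
Let O_linear : linear O. Proof. exact: freealg_lift_linear. Qed.
Let O_word s : O (\prod_(y <- s) gen k y) = foldr act m0 s.
Proof. exact: freealg_lift_word. Qed.

Let F_ind := @freealg_ind k g.

Let O_ideal r : env_ideal r -> O r = 0.
Proof.
case=> a [s [b [hs ->]]]; apply: (free_orbit_ideal F_ind O_linear O_word) => v.
case: hs => [x y|c x|x y].
- exact: (free_orbit_relD F_ind O_linear O_word).
- exact: (free_orbit_relZ F_ind O_linear O_word).
- exact: (free_orbit_relL F_ind O_linear O_word).
Qed.

Let O_proj v : env_orbit (pi v) = O v.
Proof. apply: lift_proj => r; exact: O_ideal. Qed.

Lemma env_orbit_linear : linear env_orbit.
Proof.
move=> c u v.
have E w : env_orbit w = O (repr w) by rewrite -[in LHS](proj_repr w) O_proj.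
have -> : env_orbit (c *: u + v) = O (c *: repr u + repr v).
  by rewrite -O_proj linearP /= !proj_repr.
rewrite (E u) (E v); exact: O_linear.
Qed.

Lemma env_orbit1 : env_orbit 1 = m0.
Proof.
have := freealg_lift_word (fun s => foldr act m0 s) [::].
by rewrite big_nil -env_proj1 O_proj.
Qed.

Lemma env_orbit_in x u : env_orbit (env_in x * u) = act x (env_orbit u).
Proof.
rewrite -[u]proj_repr -env_projM !O_proj.
exact: (free_orbit_gen F_ind O_linear O_word).
Qed.
End Orbit.

(** * The Dynkin operator of a derivation *)

Section Convolution.
Variables (k : fieldType) (g : lieAlgType k) (U : algType k) (iota : g -> U).
Variables (E : g -> g) (D : U -> U) (Delta : U -> tensor U U).
Variables (eps : U -> k^o) (T : U -> g).
Hypothesis U_ind : forall P : U -> Prop,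
  (forall u v, P u -> P v -> P (u + v)) ->
  (forall c s, P (c *: \prod_(x <- s) iota x)) -> forall v, P v.
Hypothesis iota_linear : linear iota.
Hypothesis iota_lie : forall x y, iota (lie x y) = iota x * iota y - iota y * iota x.
Hypothesis Delta_linear : linear Delta.
Hypothesis Delta1 : Delta 1 = 1.
Hypothesis Delta_in : forall x u,
  Delta (iota x * u) = (tens 1 (iota x) + tens (iota x) 1) * Delta u.
Hypothesis eps_linear : linear eps.
Hypothesis eps1 : eps 1 = 1.
Hypothesis eps_in : forall x u, eps (iota x * u) = 0.

Let eps_bilinear : bilinear2 (fun a b : U => (eps a : k) *: b).
Proof.
split=> [b c a a'|a c b b']; last by rewrite scalerDr !scalerA mulrC.
by rewrite eps_linear scalerDl scalerA.
Qed.
Let eps_lift (t : tensor U U) : U := tensor_lift (fun a b : U => (eps a : k) *: b) t.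
Let eps_lift_linear : linear eps_lift := tensor_lift_linear eps_bilinear.
Let eps_liftE a b : eps_lift (tens a b) = (eps a : k) *: b.
Proof. exact: tensor_liftE. Qed.

Let eps_lift_coproduct u : eps_lift (Delta u) = u.
Proof.
elim/U_ind: u => [u v hu hv|c s].
  by rewrite (plain_linearD Delta_linear) (plain_linearD eps_lift_linear) hu hv.
rewrite (plain_linearZ Delta_linear) (plain_linearZ eps_lift_linear).
congr (_ *: _); elim: s => [|x s IH].
  by rewrite big_nil Delta1 -tens11 eps_liftE eps1 scale1r.
rewrite big_cons Delta_in -[in RHS]IH.
elim/tensor_ind: (Delta _) => [t t' ht ht'|a b].
  by rewrite mulrDr !(plain_linearD eps_lift_linear) ht ht' mulrDr.
rewrite mulrDl !tensM !mul1r (plain_linearD eps_lift_linear) !eps_liftE.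
by rewrite eps_in scale0r addr0 scalerAr.
Qed.

Lemma counit_sum u I (r : seq I) (a b : I -> U) :
    Delta u = \sum_(i <- r) tens (a i) (b i) ->
  u = \sum_(i <- r) (eps (a i) : k) *: b i.
Proof.
move=> e; rewrite -[LHS]eps_lift_coproduct e (plain_linear_sum eps_lift_linear).
by apply: eq_bigr => i _; rewrite eps_liftE.
Qed.

Hypothesis D_linear : linear D.
Hypothesis D1 : D 1 = 0.
Hypothesis D_in : forall x u, D (iota x * u) = iota (E x) * u + iota x * D u.
Hypothesis T_linear : linear T.
Hypothesis T1 : T 1 = 0.
Hypothesis T_in : forall x u,
  T (iota x * u) = (eps u : k) *: E x + lie x (T u).

Let T_bilinear : bilinear2 (fun a b : U => iota (T a) * b).
Proof.
split=> [b c a a'|a c b b'].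
  by rewrite T_linear iota_linear mulrDl -scalerAl.
by rewrite mulrDr -scalerAr.
Qed.
Let T_lift (t : tensor U U) : U := tensor_lift (fun a b : U => iota (T a) * b) t.
Let T_lift_linear : linear T_lift := tensor_lift_linear T_bilinear.
Let T_liftE a b : T_lift (tens a b) = iota (T a) * b.
Proof. exact: tensor_liftE. Qed.

(** The derivation extending E is the convolution of T with the identity,
    D u = \sum T(u_1) u_2. For u = x w with x in the Lie algebra, the coproduct
    is multiplied by x (x) 1 + 1 (x) x, and T(x w_1) = eps(w_1) E x + [x, T w_1],
    so that the sum becomes (E x) w + x \sum T(w_1) w_2. *)
Lemma dynkin_convolution u : D u = T_lift (Delta u).
Proof.
elim/U_ind: u => [u v hu hv|c s].
  rewrite (plain_linearD Delta_linear) (plain_linearD T_lift_linear).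
  by rewrite -hu -hv (plain_linearD D_linear).
rewrite (plain_linearZ Delta_linear) (plain_linearZ T_lift_linear).
rewrite (plain_linearZ D_linear); congr (_ *: _); elim: s => [|x s IH].
  rewrite big_nil Delta1 -tens11 T_liftE T1 (plain_linear0 iota_linear) mul0r.
  exact: D1.
rewrite big_cons D_in Delta_in IH -{1}[\prod_(y <- s) _]eps_lift_coproduct.
elim/tensor_ind: (Delta _) => [t t' ht ht'|a b].
  rewrite mulrDr !(plain_linearD T_lift_linear) (plain_linearD eps_lift_linear).
  by rewrite -ht -ht' !mulrDr addrACA.
rewrite mulrDl !tensM !mul1r (plain_linearD T_lift_linear) eps_liftE !T_liftE T_in.
rewrite (plain_linearD iota_linear) (plain_linearZ iota_linear) iota_lie.
rewrite mulrDl mulrBl !mulrA -scalerAl -scalerAr [RHS]addrC -addrA.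
by rewrite subrK.
Qed.

Lemma dynkin_sum u I (r : seq I) (a b : I -> U) :
    Delta u = \sum_(i <- r) tens (a i) (b i) ->
  D u = \sum_(i <- r) iota (T (a i)) * b i.
Proof.
move=> e; rewrite dynkin_convolution e (plain_linear_sum T_lift_linear).
by apply: eq_bigr => i _; rewrite T_liftE.
Qed.
End Convolution.

Section Dynkin.
Variables (k : fieldType) (g : lieAlgType k) (E : {linear g -> g}).
Hypothesis E_der : forall x y, E (lie x y) = lie (E x) y + lie x (E y).

(** The adjoint action of g on its semidirect product with k E, the pair (c, y)
    standing for y - c E. Under it, the word x_1 ... x_r maps (1, 0) to
    (0, [x_1, [..., [x_(r-1), E x_r]]]) when r > 0. *)
Definition euler_act (x : g) (m : (k^o * g)%type) : (k^o * g)%type :=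
  (0, (m.1 : k) *: (E x : g) + lie x m.2).

Let act_linearl m : linear (euler_act^~ m).
Proof.
move=> c x y; congr (_, _); first by rewrite /= scaler0 addr0.
rewrite /= linearP lieDl lieZl !scalerDr !scalerA [m.1 * c]mulrC.
by rewrite addrACA.
Qed.
Let act_linearr x : linear (euler_act x).
Proof.
move=> c [a y] [b z]; congr (_, _); first by rewrite /= scaler0 addr0.
by rewrite /= lieDr lieZr scalerDl scalerDr scalerA addrACA.
Qed.
Let act_lie x y m :
  euler_act (lie x y) m =
  euler_act x (euler_act y m) - euler_act y (euler_act x m).
Proof.
case: m => a z; congr (_, _); first by rewrite /= subr0.
rewrite /= !scale0r !add0r E_der lie_lie !lieDr !lieZr opprD addrACA.
by rewrite -scalerBr (lieC (E x) y) [- _ + _]addrC.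
Qed.

Definition euler_orbit : env g -> (k^o * g)%type := env_orbit euler_act (1, 0).
Definition counit (u : env g) : k := (euler_orbit u).1.
Definition dynkin (u : env g) : g := (euler_orbit u).2.

Lemma counit_linear : linear (counit : env g -> k^o).
Proof. by move=> c u v; rewrite /counit /euler_orbit env_orbit_linear. Qed.
Lemma dynkin_linear : linear dynkin.
Proof. by move=> c u v; rewrite /dynkin /euler_orbit env_orbit_linear. Qed.

Lemma counit1 : counit 1 = 1.
Proof. by rewrite /counit /euler_orbit env_orbit1. Qed.
Lemma counit_inM x u : counit (env_in x * u) = 0.
Proof. by rewrite /counit /euler_orbit env_orbit_in. Qed.
Lemma dynkin1 : dynkin 1 = 0.
Proof. by rewrite /dynkin /euler_orbit env_orbit1. Qed.
Lemma dynkin_inM x u :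
  dynkin (env_in x * u) = counit u *: E x + lie x (dynkin u).
Proof. by rewrite /dynkin /euler_orbit env_orbit_in. Qed.

Lemma dynkin_in x : dynkin (env_in x) = E x.
Proof. by rewrite -[env_in x]mulr1 dynkin_inM counit1 dynkin1 lie0r addr0 scale1r. Qed.

End Dynkin.

(** * The Euler derivation of a graded Lie algebra *)

Section EulerGraded.
Variables (k : fieldType) (g : gradedLieAlgType k).
Implicit Types x y : g.

Lemma gr0 n : gr n (0 : g).
Proof.
have [m [b bP]] := gr_fin_dim (s := g) n; apply/bP; exists (fun=> 0).
by rewrite big1 // => i _; rewrite scale0r.
Qed.
Lemma grP n c x y : gr n x -> gr n y -> gr n (c *: x + y).
Proof.
have [m [b bP]] := gr_fin_dim (s := g) n.
move=> /bP[a ->] /bP[a' ->]; apply/bP; exists (fun i => c * a i + a' i).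
rewrite scaler_sumr -big_split; apply: eq_bigr => i _.
by rewrite scalerDl scalerA.
Qed.

(** The graph of the Euler derivation x = \sum_n x_n |-> \sum_n n x_n. *)
Definition euler_graph x e : Prop := exists (f : nat -> g) N,
  (forall n, gr n (f n)) /\ (forall M, (N <= M)%N ->
    \sum_(n < M) f n = x /\ \sum_(n < M) f n *+ n = e).

Lemma euler_graphP c x e y e' : euler_graph x e -> euler_graph y e' ->
  euler_graph (c *: x + y) (c *: e + e').
Proof.
move=> [f [N [fgr fP]]] [h [N' [hgr hP]]].
exists (fun n => c *: f n + h n), (maxn N N'); split=> [n|M]; first exact: grP.
rewrite geq_max => /andP[/fP[<- <-] /hP[<- <-]]; rewrite !scaler_sumr -!big_split.
by split=> //; apply: eq_bigr => i _; rewrite /= mulrnDl scalerMnr.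
Qed.

Lemma euler_graph_gr n x : gr n x -> euler_graph x (x *+ n).
Proof.
move=> gx; exists (fun m => if m == n then x else 0), n.+1; split=> [m|M ltnM].
  by case: eqP => [->|_]; [|exact: gr0].
rewrite -(big_mkord xpredT (fun m => if m == n then x else 0)).
rewrite -(big_mkord xpredT (fun m => (if m == n then x else 0) *+ m)) /=.
have S (F : nat -> g) : (forall m, m != n -> F m = 0) ->
    \sum_(0 <= m < M) F m = F n.
  move=> F0; rewrite (bigD1_seq n) ?mem_index_iota ?iota_uniq //=.
  by rewrite big1 ?addr0.
by rewrite !S ?eqxx // => m /negPf ->; rewrite ?mul0rn.
Qed.

Lemma euler_graph_fun x e e' : euler_graph x e -> euler_graph x e' -> e = e'.
Proof.
move=> he he'; apply/eqP; rewrite -subr_eq0; apply/eqP.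
have := euler_graphP (-1) he' he; rewrite !scaleN1r addNr addrC.
case=> f [N [fgr fP]]; have [f0 <-] := fP N (leqnn N).
by apply: big1 => i _; rewrite (gr_direct N f fgr f0 i) mul0rn.
Qed.

Lemma euler_graph0 : euler_graph 0 0.
Proof. by have := euler_graph_gr (gr0 0); rewrite mulr0n. Qed.

Lemma euler_graph_sum I (r : seq I) (F G : I -> g) :
    (forall i, euler_graph (F i) (G i)) ->
  euler_graph (\sum_(i <- r) F i) (\sum_(i <- r) G i).
Proof.
move=> FG; elim: r => [|i r IH]; first by rewrite !big_nil; apply: euler_graph0.
by rewrite !big_cons; have := euler_graphP 1 (FG i) IH; rewrite !scale1r.
Qed.

Lemma euler_graph_total x : exists e, euler_graph x e.
Proof.
have [N [f [fgr ->]]] := gr_total x; exists (\sum_(n < N) f n *+ n).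
by apply: euler_graph_sum => i; apply: euler_graph_gr.
Qed.

Definition graded_euler x : g := projT1 (cid (euler_graph_total x)).

Lemma graded_eulerP x : euler_graph x (graded_euler x).
Proof. exact: (projT2 (cid (euler_graph_total x))). Qed.

Lemma graded_euler_gr n x : gr n x -> graded_euler x = x *+ n.
Proof. by move/euler_graph_gr; apply: euler_graph_fun; apply: graded_eulerP. Qed.

Fact graded_euler_linear : linear graded_euler.
Proof.
move=> c x y; apply: euler_graph_fun (graded_eulerP _) _.
by apply: euler_graphP; apply: graded_eulerP.
Qed.
HB.instance Definition _ :=
  GRing.isLinear.Build k g g _ graded_euler graded_euler_linear.

Lemma graded_ind (P : g -> Prop) : P 0 ->
  (forall x y, P x -> P y -> P (x + y)) -> (forall n x, gr n x -> P x) ->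
  forall x, P x.
Proof.
move=> P0 PD Pgr x; have [N [f [fgr ->]]] := gr_total x.
by apply: big_ind => // i _; apply: Pgr (fgr i).
Qed.

Lemma graded_euler_lie x y :
  graded_euler (lie x y) = lie (graded_euler x) y + lie x (graded_euler y).
Proof.
elim/graded_ind: x => [|x x' hx hx'|n x gx].
- by rewrite linear0 !lie0l linear0 addr0.
- by rewrite lieDl !linearD /= !lieDl hx hx' addrACA.
elim/graded_ind: y => [|y y' hy hy'|m y gy].
- by rewrite linear0 !lie0r linear0 addr0.
- by rewrite lieDr !linearD /= !lieDr hy hy' addrACA.
rewrite (graded_euler_gr gx) (graded_euler_gr gy).
rewrite (graded_euler_gr (gr_lie n m x y gx gy)).
rewrite -[x *+ n]scaler_nat -[y *+ m]scaler_nat.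
by rewrite lieZl lieZr !scaler_nat mulrnDr.
Qed.
End EulerGraded.

Section EulerCurrent.
Variables (k : fieldType) (A : comAlgType k) (g : gradedLieAlgType k).
Local Notation L := (tensor A g).

Let euler_bilinear :
  bilinear2 (fun (a : A) (u : g) => tens a (graded_euler u)).
Proof.
split=> [u c a b|a c u v]; first by rewrite tensDl tensZl.
by rewrite linearP tensDr tensZr.
Qed.

Definition current_euler : L -> L :=
  tensor_lift (fun (a : A) (u : g) => tens a (graded_euler u)).

Fact current_euler_linear : linear current_euler.
Proof. exact: tensor_lift_linear. Qed.
HB.instance Definition _ :=
  GRing.isLinear.Build k L L _ current_euler current_euler_linear.

Lemma current_euler_lie x y :
  current_euler (lie x y) = lie (current_euler x) y + lie x (current_euler y).
Proof.
elim/tensor_ind: x => [s t hs ht|a u].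
  by rewrite lieDl !linearD /= !lieDl hs ht addrACA.
elim/tensor_ind: y => [s t hs ht|b v].
  by rewrite lieDr !linearD /= !lieDr hs ht addrACA.
have eE (c : A) (w : g) : current_euler (tens c w) = tens c (graded_euler w).
  exact: tensor_liftE.
by rewrite !(tens_lie, eE) graded_euler_lie tensDr.
Qed.

Lemma current_euler_gr n (x : L) : cur_gr n x -> current_euler x = x *+ n.
Proof.
elim=> [|y z _ hy _ hz|c y [a [u [gu ->]]]].
- by rewrite linear0 mul0rn.
- by rewrite linearD /= hy hz mulrnDl.
rewrite linearZ /= scalerMnr; congr (_ *: _).
rewrite [LHS]tensor_liftE // (graded_euler_gr gu).
by rewrite -!scaler_nat tensZr.
Qed.
End EulerCurrent.

(** * Gradings *)

Section Grading.
Variables (k : fieldType) (A : comAlgType k) (g : gradedLieAlgType k).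
Local Notation L := (tensor A g).
Local Notation U := (env L).
Local Notation E := (@current_euler k A g).
Implicit Types x y : L.
Implicit Types u v : U.

Lemma cur_gr_eq0 x : cur_gr 0 x -> x = 0.
Proof.
elim=> [//|y z _ -> _ ->|c y [a [w [/gr_pos -> ->]]]]; first by rewrite addr0.
by rewrite -(scale0r (0 : g)) tensZr scale0r scaler0.
Qed.

Lemma cur_gr_lie n m x y : cur_gr n x -> cur_gr m y -> cur_gr (n + m) (lie x y).
Proof.
move=> hx hy; elim: hx => [|x' x'' _ h1 _ h2|c x' [a [v [gv ->]]]].
- by rewrite lie0l; apply: span0.
- by rewrite lieDl; apply: spanD.
rewrite lieZl; apply: span_scale; elim: hy => [|y' y'' _ h1 _ h2|c' y' [b [w [gw ->]]]].
- by rewrite lie0r; apply: span0.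
- by rewrite lieDr; apply: spanD.
rewrite lieZr; apply/span_scale/span_sub; rewrite tens_lie.
by exists (a * b), (lie v w); split=> //; exact: gr_lie.
Qed.

Lemma env_word_cat n m u v : env_word n u -> env_word m v -> env_word (n + m) (u * v).
Proof.
move=> hu hv; elim: hu => [|i j x w hx _ IH]; first by rewrite mul1r.
by rewrite -addnA -mulrA; apply: EnvWordS.
Qed.

Lemma env_gr1 : env_gr 0 (1 : U).
Proof. by apply: span_sub; apply: EnvWord0. Qed.

Lemma env_gr_mul n m u v : env_gr n u -> env_gr m v -> env_gr (n + m) (u * v).
Proof.
move=> hu hv; elim: hu => [|u' u'' _ h1 _ h2|c u' wu].
- by rewrite mul0r; apply: span0.
- by rewrite mulrDl; apply: spanD.
rewrite -scalerAl; apply: span_scale; elim: hv => [|v' v'' _ h1 _ h2|c' v' wv].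
- by rewrite mulr0; apply: span0.
- by rewrite mulrDr; apply: spanD.
by rewrite -scalerAr; apply/span_scale/span_sub; apply: env_word_cat.
Qed.

Lemma env_gr_in n x : cur_gr n x -> env_gr n (env_in x).
Proof.
move=> hx; apply: span_sub; rewrite -[env_in x]mulr1 -[n]addn0.
by apply: EnvWordS => //; apply: EnvWord0.
Qed.

Local Notation E_der := (@current_euler_lie k A g).

Lemma env_euler_gr n u : env_gr n u -> env_der E u = u *+ n.
Proof.
have Dlin := env_der_linear E_der.
elim=> [|v w _ hv _ hw|c w ww]; first by rewrite (plain_linear0 Dlin) mul0rn.
  by rewrite (plain_linearD Dlin) hv hw mulrnDl.
rewrite (plain_linearZ Dlin) scalerMnr; congr (_ *: _).
elim: ww => [|i m x v hx _ IH]; first by rewrite (env_der1 E_der) mulr0n.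
rewrite (env_derM E_der) (env_der_in E_der) IH /= (current_euler_gr hx).
have -> : env_in (x *+ i) = env_in x *+ i by rewrite -!scaler_nat env_inZ.
by rewrite mulrnAl mulrnAr mulrnDr.
Qed.

Local Notation eps_linear := (counit_linear E_der).
Local Notation T_linear := (dynkin_linear E_der).

Lemma counit_gr n u : env_gr n u -> (0 < n)%N -> counit E u = 0.
Proof.
move=> hu n0; elim: hu => [|v w _ hv _ hw|c w ww].
- exact: plain_linear0 eps_linear.
- by rewrite (plain_linearD eps_linear) hv hw addr0.
rewrite (plain_linearZ eps_linear); case: ww n0 => // i m x v _ _ _.
by rewrite (counit_inM E_der) scaler0.
Qed.

Lemma env_gr0_scalar u : env_gr 0 u -> exists c : k, u = c *: 1.
Proof.
elim=> [|v w _ [a ->] _ [b ->]|c w ww]; first by exists 0; rewrite scale0r.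
  by exists (a + b); rewrite scalerDl.
suff [b ->] : exists b : k, w = b *: 1 by exists (c * b); rewrite scalerA.
move en : 0%N ww => n ww; case: ww en => [_|i m x v hx _ /esym/eqP].
  by exists 1; rewrite scale1r.
rewrite addn_eq0 => /andP[/eqP i0 _]; rewrite i0 in hx.
by exists 0; rewrite (cur_gr_eq0 hx) env_in0 mul0r scale0r.
Qed.

Lemma env_gr0P u : env_gr 0 u -> u = (counit E u : k) *: 1.
Proof.
move=> /env_gr0_scalar[c e]; suff h : counit E u = c :> k by rewrite h.
rewrite e (plain_linearZ eps_linear) (counit1 E_der); exact: mulr1 c.
Qed.

Lemma dynkin_gr n u : env_gr n u -> cur_gr n (dynkin E u).
Proof.
elim=> [|v w _ hv _ hw|c w ww].
- by rewrite (plain_linear0 T_linear); apply: span0.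
- by rewrite (plain_linearD T_linear); apply: spanD.
rewrite (plain_linearZ T_linear); apply: span_scale.
elim: ww => [|i m x v hx wv IH]; first by rewrite (dynkin1 E_der); apply: span0.
rewrite (dynkin_inM E_der); apply: spanD; last exact: cur_gr_lie.
case: m wv {IH} => [|m] wv; last first.
  by rewrite (counit_gr (span_sub wv)) // scale0r; apply: span0.
rewrite addn0 /= (current_euler_gr hx) -scaler_nat.
by do 2!apply: span_scale.
Qed.

Hypothesis k_char0 : [pchar k] =i pred0.

(** The Dynkin operator multiplies L_n by n, hence detects it in U: the grading
    gives this part of the Poincare-Birkhoff-Witt theorem. *)
Lemma env_in_eq0 n x : cur_gr n x -> env_in x = 0 -> x = 0.
Proof.
move=> hx x0; have := dynkin_in E_der x.
rewrite x0 (plain_linear0 T_linear) /= (current_euler_gr hx).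
by case: n hx => [/cur_gr_eq0-> //|n _ /esym]; apply: mulrSn_eq0.
Qed.
End Grading.

(** * The enveloping algebra of a graded current algebra *)

HB.instance Definition _ (k : fieldType) (g : lieAlgType k) :=
  GRing.isLinear.Build k (env g) (tensor (env g) (env g)) _ (@coproduct k g)
    (@coproduct_linear k g).
HB.instance Definition _ (k : fieldType) (g : lieAlgType k) :=
  GRing.isMonoidMorphism.Build (env g) (tensor (env g) (env g)) (@coproduct k g)
    (conj (@coproduct1 k g) (@coproductM k g)).

Section CurrentEnvelope.
Variables (k : fieldType) (A : comAlgType k) (g : gradedLieAlgType k).
Hypothesis k_char0 : [pchar k] =i pred0.
Local Notation L := (tensor A g).
Local Notation U := (env L).
Local Notation E := (@current_euler k A g).
Local Notation E_der := (@current_euler_lie k A g).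

Let cur_grP n c (x y : L) : cur_gr n x -> cur_gr n y -> cur_gr n (c *: x + y).
Proof. by move=> hx hy; apply: spanD => //; apply: span_scale. Qed.
Let env_grP n c (u v : U) : env_gr n u -> env_gr n v -> env_gr n (c *: u + v).
Proof. by move=> hx hy; apply: spanD => //; apply: span_scale. Qed.

Let cop_in (x : L) u : coproduct (env_in x * u) =
  (tens 1 (env_in x) + tens (env_in x) 1) * coproduct u.
Proof. by rewrite coproductM coproduct_in. Qed.

Let D_in (x : L) u :
  env_der E (env_in x * u) = env_in (E x) * u + env_in x * env_der E u.
Proof. by rewrite (env_derM E_der) (env_der_in E_der). Qed.

Let cop_counit (u : U) n (a b : nat -> U) :
    coproduct u = \sum_(i < n) tens (a i) (b i) ->
  u = \sum_(i < n) counit E (a i) *: b i.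
Proof.
exact: (counit_sum (@env_ind k L) (@coproduct_linear k L) (@coproduct1 k L) cop_in
  (counit_linear E_der) (counit1 E_der) (counit_inM E_der)).
Qed.

Let cop_dynkin m (u : U) n (a b : nat -> U) : env_gr m u ->
    coproduct u = \sum_(i < n) tens (a i) (b i) ->
  u *+ m = \sum_(i < n) env_in (dynkin E (a i)) * b i.
Proof.
move=> /env_euler_gr <-.
exact: (dynkin_sum (@env_ind k L) (@env_in_linear k L) (@env_in_lie k L)
  (@coproduct_linear k L) (@coproduct1 k L) cop_in
  (counit_linear E_der) (counit1 E_der) (counit_inM E_der) (env_der_linear E_der)
  (env_der1 E_der) D_in (dynkin_linear E_der) (dynkin1 E_der) (dynkin_inM E_der)).
Qed.

Definition current_envelope : graded_envelope k :=
  @GradedEnvelope k L U (@cur_gr k A g) (@env_gr k A g) (@env_in k L)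
    (@coproduct k L) (counit E) (dynkin E)
    (fun n => span0 _) cur_grP (@cur_gr_eq0 k A g) (@cur_gr_lie k A g)
    (fun n => span0 _) env_grP (@env_gr1 k A g) (@env_gr_mul k A g)
    (@env_gr_in k A g) (@env_in_linear k L) (@env_in_lie k L)
    (@env_in_eq0 k A g k_char0) (@coproduct_in k L) (@env_gr0P k A g)
    (@counit_gr k A g) cop_counit (@dynkin_gr k A g) cop_dynkin.

Lemma hexpE (f : nat -> U) : hexp f = series_exp (f : series U).
Proof.
have e m : iter m (hmul f) (@hone k A g) = (f : series U) ^+ m.
  by elim: m => [//|m IH]; rewrite iterS IH exprS.
by apply/funext => n; apply: eq_bigr => m _; rewrite e.
Qed.
End CurrentEnvelope.

(** * The conjugacy theorem *)

Section Homogeneous.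
Variables (k : fieldType) (A : comAlgType k) (g : gradedLieAlgType k).
Local Notation L := (tensor A g).
Variable d : {linear L -> L}.
Hypothesis d_gr : forall n (x : L), cur_gr n x -> cur_gr n (d x).
Hypothesis d_sum : ker_im_direct_sum d.

Let single n (x : L) (m : nat) : L := if m == n then x else 0.

Let prodL_single n x : cur_gr n x -> prodL (single n x).
Proof. by move=> hx m; rewrite /single; case: eqP => [->|_] //; apply: span0. Qed.

(** The decomposition of prodL, read on series with a single component. *)
Lemma ker_im_homogeneous n (x : L) : cur_gr n x ->
  exists b c, [/\ cur_gr n b, d b = 0, cur_gr n c & x = b + d c].
Proof.
move=> hx; have [a [b [[La da] [c Lc bc] e]]] := d_sum.1 _ (prodL_single hx).
exists (a n), (c n); split=> //.
by have := e n; rewrite /single eqxx bc.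
Qed.

Lemma ker_im_trivial n (x : L) : cur_gr n x -> d (d x) = 0 -> d x = 0.
Proof.
move=> hx ddx; have := d_sum.2 (single n (d x)) _ _ n.
rewrite /single eqxx; apply.
  split; first by apply/prodL_single/d_gr.
  by move=> m; rewrite /single; case: eqP => // _; rewrite linear0.
exists (single n x); first exact: prodL_single.
by move=> m; rewrite /single; case: eqP => // _; rewrite linear0.
Qed.
End Homogeneous.

Theorem theorem4 (k : fieldType) (k_char0 : [pchar k] =i pred0)
    (g : gradedLieAlgType k) (A : comAlgType k)
    (d : {linear tensor A g -> tensor A g}) (d_der : derivation d)
    (d_sum : ker_im_direct_sum d)
    (u : nat -> tensor A g) (u_L : prodL u) :
  (exists v, kerL d v /\ conjugate d u v) /\
  (forall v, kerL d v -> conjugate d v u ->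
     forall w, kerL d w ->
       (conjugate d w u <->
        exists phi, exp_kerL d phi /\
          forall n, hmul (hin v) phi n = hmul phi (hin w) n)).
Proof.
have [d_gr d_lie] := d_der.
have main := @conj_ker_theorem k (current_envelope A g k_char0) k_char0 d (env_der d)
  (@linearP _ _ _ _ d) d_lie d_gr (env_der_linear d_lie) (env_derM d_lie)
  (env_der_in d_lie) (ker_im_homogeneous d_sum) (ker_im_trivial d_gr d_sum).
have [exist uniq] := main u u_L.
have conjE x y : conjugate d x y <->
    @conj_series k (current_envelope A g k_char0) (env_der d) x y.
  split=> -[phi [glphi e]]; exists phi; split=> //; first exact/funext.
  by move=> n; apply: (congr1 (fun f : series _ => f n) e).
split; first by have [v [kv /conjE cv]] := exist; exists v.
move=> v kv /conjE vu w kw; split=> [/conjE wu|[phi [[x [kx ephi]] e]]].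
  have [x [kx e]] := (uniq v kv vu w kw).1 wu.
  exists (hexp (hin x)); split; first by exists x.
  by move=> n; rewrite hexpE; apply: (congr1 (fun f : series _ => f n) e).
apply/conjE/(uniq v kv vu w kw); exists x; split=> //.
have {}ephi : phi = series_exp (hin x : series _).
  by rewrite -hexpE; apply/funext.
by rewrite ephi in e; apply/funext.
Qed.
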